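(* Let $k\ge1$ be an integer. For each $n\ge 1$ let $(X_n^{(1)},\dots,X_n^{(k)})$ and $(Y_n^{(1)},\dots,Y_n^{(k)})$ be two random $k$-tuples of finitely generated abelian groups. Let $a$ be a positive integer and let $\mathcal{A}_a$ be the set of isomorphism classes of finite abelian groups with exponent dividing $a$. Suppose that for every $G_1,\dots,G_k\in\mathcal{A}_a$, $$\lim_{n\to\infty}\mathbf{E}\Big[\prod_{i=1}^k\#\mathrm{Sur}(X_n^{(i)},G_i)\Big]=\lim_{n\to\infty}\mathbf{E}\Big[\prod_{i=1}^k\#\mathrm{Sur}(Y_n^{(i)},G_i)\Big]=m_k(G_1,\dots,G_k).$$ Then for every $H_1,\dots,H_k\in\mathcal{A}_a$ the limit $\lim_{n\to\infty}\mathbf{P}\big(X_n^{(i)}\otimes(\mathbb{Z}/a\mathbb{Z})\simeq H_i\ \text{for all }1\le i\le k\big)$ exists, and for every $G_1,\dots,G_k\in\mathcal{A}_a$ $$\sum_{H_1,\dots,H_k\in\mathcal{A}_a}\lim_{n\to\infty}\mathbf{P}\big(X_n^{(i)}\otimes(\mathbb{Z}/a\mathbb{Z})\simeq H_i\ \forall\,1\le i\le k\big)\prod_{i=1}^k\#\mathrm{Sur}(H_i,G_i)=m_k(G_1,\dots,G_k).$$ Furthermore, for every $H_1,\dots,H_k\in\mathcal{A}_a$, $$\lim_{n\to\infty}\mathbf{P}\big(X_n^{(i)}\otimes(\mathbb{Z}/a\mathbb{Z})\simeq H_i\ \forall\,1\le i\le k\big)=\lim_{n\to\infty}\mathbf{P}\big(Y_n^{(i)}\otimes(\mathbb{Z}/a\mathbb{Z})\simeq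 H_i\ \forall\,1\le i\le k\big).$$
   Context: $\mathrm{Sur}(A,B)$ is the set of surjective group homomorphisms $A\to B$. For finite abelian groups $G_1,\dots,G_k$, let $\pi_i$ denote projection onto the summand $G_i$ and $\pi_I$ projection onto $\bigoplus_{i\in I}G_i$. Then $m_k(G_1,\dots,G_k)$ is the number of sequences $(H_1,\dots,H_k)$ such that $H_k=G_k$ and for each $i=1,\dots,k-1$: $H_i\le G_i\oplus\cdots\oplus G_k$, $\pi_i(H_i)=G_i$, and $\pi_{\{i+1,\dots,k\}}(H_i)\le H_{i+1}$. *)

(* Defs.v *)
From HB Require Import structures.
From mathcomp Require Import all_boot all_order all_algebra.
From mathcomp Require Import finmap.
From mathcomp Require Import fingroup morphism gproduct abelian.
From mathcomp Require Import all_classical all_reals all_analysis.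
From mathcomp Require Import generic_quotient ring_quotient freeg.

Set Implicit Arguments.
Unset Strict Implicit.
Unset Printing Implicit Defensive.

Import Order.TTheory GRing.Theory Num.Theory.
Import numFieldNormedType.Exports.
Local Open Scope ring_scope.

Definition zmod_iso (A B : zmodType) : Prop :=
  exists f : {additive A -> B}, bijective f.

Definition fin_gen (A : zmodType) : Prop :=
  exists (r : nat) (g : 'I_r -> A),
    forall x : A, exists c : 'I_r -> int, x = \sum_(i < r) g i *~ c i.

Record fgAbGroup := FgAbGroup {
  fgab_sort :> zmodType;
  fgab_fin_gen : fin_gen fgab_sort }.

Definition Sur (A B : zmodType) : set (A -> B) :=
  [set f | zmod_morphism f /\ (forall y, exists x, f x = y)]%classic.
Arguments Sur : clear implicits.

(* [fset_set] sends infinite sets to the empty set; [Sur_finite] below shows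
   that this does not happen when [A] is finitely generated and [B] finite. *)
Definition nSur (A B : zmodType) : nat := #|` fset_set (Sur A B)|.

Lemma Sur_finite (A : zmodType) (B : finZmodType) :
  fin_gen A -> finite_set (Sur A B).
Proof.
move=> [r [g gA]].
have extA (f : A -> B) : zmod_morphism f ->
    forall c : 'I_r -> int, f (\sum_i g i *~ c i) = \sum_i f (g i) *~ c i.
  move=> fB c.
  pose m := GRing.isZmodMorphism.Build A B f fB.
  pose f' : {additive A -> B} := HB.pack f m.
  rewrite -[f]/(f' : A -> B) raddf_sum; apply: eq_bigr => i _.
  by rewrite raddfMz.
have [c cE] := choice gA.
pose phi (u : {ffun 'I_r -> B}) (x : A) : B := \sum_i u i *~ c x i.
apply: (@sub_finite_set _ _ (phi @` setT)%classic).
  move=> f [fB _]; exists [ffun i => f (g i)] => //; apply/funext => x.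
  by rewrite /phi [in RHS](cE x) extA//; apply: eq_bigr => i _; rewrite ffunE.
exact: finite_image.
Qed.

Definition exponent_dvd (a : nat) (G : finZmodType) : bool :=
  (exponent [set: G]%SET %| a)%N.

(* An isomorphism class is encoded by the set of all addition tables on an
   initial segment of nat that are isomorphic to the group: [iso_classP].  The
   quotient of the large type [finZmodType] is thereby a small type. *)
Record table := Table { table_size : nat;
  table_op : 'I_table_size -> 'I_table_size -> 'I_table_size }.

Definition iso_class (G : finZmodType) : set table :=
  [set t | exists2 f : G -> 'I_(table_size t), bijective f &
     {morph f : x y / x + y >-> table_op x y}]%classic.

(* The set of isomorphism classes of finite abelian groups of exponent
   dividing [a], with a chosen representative [AbClass_rep] of each class. *)
Definition AbClass (a : nat) : Type :=
  {c : set table | exists2 G : finZmodType, exponent_dvd a G & c = iso_class G}.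

HB.instance Definition _ a := gen_eqMixin (AbClass a).
HB.instance Definition _ a := gen_choiceMixin (AbClass a).

Definition AbClass_rep a (c : AbClass a) : finZmodType := projT1 (cid2 (svalP c)).

Lemma AbClass_rep_exponent a (c : AbClass a) : exponent_dvd a (AbClass_rep c).
Proof. by rewrite /AbClass_rep; case: cid2. Qed.

Lemma iso_classP (G H : finZmodType) :
  iso_class G = iso_class H <-> zmod_iso G H.
Proof.
split=> [eGH|[f [g fK gK]]].
- pose op (i j : 'I_#|G|) := enum_rank (enum_val i + enum_val j).
  have : iso_class G (Table op).
    exists enum_rank; first exact: (Bijective enum_rankK enum_valK).
    by move=> x y; rewrite /= /op !enum_rankK.
  rewrite eGH => -[/= u [v uK vK] uD].
  have enumD (x y : G) : enum_rank (x + y) = op (enum_rank x) (enum_rank y).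
    by rewrite /op !enum_rankK.
  pose f (x : G) : H := v (enum_rank x).
  have fD : {morph f : x y / x + y}.
    by move=> x y; rewrite /f enumD; apply: (can_inj uK); rewrite uD !vK.
  have fB : zmod_morphism f.
    by move=> x y; apply/eqP; rewrite eq_sym subr_eq -fD subrK.
  pose m := GRing.isZmodMorphism.Build G H f fB.
  pose f' : {additive G -> H} := HB.pack f m.
  exists f'; exists (fun y => enum_val (u y)) => x; rewrite /= /f.
  + by rewrite vK enum_rankK.
  + by rewrite enum_valK uK.
- apply/seteqP; split=> t [u ubij uD].
  + exists (u \o g); first by apply: bij_comp => //; exact: (Bijective gK fK).
    by move=> x y /=; rewrite -uD -{1}(gK x) -{1}(gK y) -raddfD fK.
  + exists (u \o f); first by apply: bij_comp => //; exact: (Bijective fK gK).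
    by move=> x y /=; rewrite raddfD uD.
Qed.

Lemma AbClass_repP a (G : finZmodType) : exponent_dvd a G ->
  exists! c : AbClass a, zmod_iso G (AbClass_rep c).
Proof.
move=> Ga.
exists (exist _ (iso_class G) (ex_intro2 _ _ G Ga erefl)); split.
  by apply/iso_classP; rewrite /AbClass_rep; case: cid2.
move=> [c cP] /iso_classP; rewrite /AbClass_rep; case: cid2 => H _ /= cH GH.
have {GH cH}eGc : iso_class G = c by rewrite GH -cH.
by subst c; congr exist; exact: Prop_irrelevance.
Qed.

Section Tensor.
Variables A B : zmodType.

(* The quotient of the free abelian group on A * B by the subgroup generated
   by the bilinearity relations. *)
Definition freeAB : zmodType := {freeg (A * B)%type / int}.
Definition fgen (a : A) (b : B) : freeAB := << (a, b) >>.

Definition tensor_relations : set freeAB :=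
  ([set x | exists a a' b, x = fgen (a + a') b - fgen a b - fgen a' b] `|`
   [set x | exists a b b', x = fgen a (b + b') - fgen a b - fgen a b'])%classic.

Definition tensor_null : {pred freeAB} := fun x =>
  `[< forall S : {pred freeAB}, zmod_closed S ->
      (forall y, tensor_relations y -> y \in S) -> x \in S >].

Lemma tensor_null_closed : zmod_closed tensor_null.
Proof.
split=> [|x y xN yN]; apply/asboolP=> S S0 SR; first by case: S0.
by have [_] := S0; apply; [move/asboolP: xN; apply|move/asboolP: yN; apply].
Qed.

HB.instance Definition _ :=
  GRing.isZmodClosed.Build freeAB tensor_null tensor_null_closed.

Definition tensor : zmodType := Quotient.quot tensor_null.
Definition tmul (a : A) (b : B) : tensor := \pi_(Quotient.quot tensor_null)%qT (fgen a b).

Lemma tensor_null_rel x : tensor_relations x -> x \in tensor_null.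
Proof. by move=> xR; apply/asboolP => S _; apply. Qed.

Lemma pi_tensor_eq x y : x - y \in tensor_null ->
  \pi_(Quotient.quot tensor_null)%qT x = \pi_(Quotient.quot tensor_null)%qT y.
Proof. by rewrite Quotient.idealrBE => /eqP. Qed.

Lemma tmulDl a a' b : tmul (a + a') b = tmul a b + tmul a' b.
Proof.
rewrite /tmul -raddfD; apply/pi_tensor_eq/tensor_null_rel.
by left; exists a, a', b; rewrite opprD addrA.
Qed.

Lemma tmulDr a b b' : tmul a (b + b') = tmul a b + tmul a b'.
Proof.
rewrite /tmul -raddfD; apply/pi_tensor_eq/tensor_null_rel.
by right; exists a, b, b'; rewrite opprD addrA.
Qed.

Lemma tensor_universal (C : zmodType) (f : A -> B -> C) :
  (forall a a' b, f (a + a') b = f a b + f a' b) ->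
  (forall a b b', f a (b + b') = f a b + f a b') ->
  exists g : {additive tensor -> C}, (forall a b, g (tmul a b) = f a b) /\
    forall g' : {additive tensor -> C}, (forall a b, g' (tmul a b) = f a b) ->
      g' =1 g.
Proof.
move=> fDl fDr.
pose F : freeAB -> zmodule C := fglift (fun z => f z.1 z.2 : zmodule C).
have FB : zmod_morphism F by exact: lift_is_additive.
have Fgen a b : F (fgen a b) = f a b by rewrite /F /fgen liftU scale1r.
have FN x : x \in tensor_null -> F x = 0.
  pose K : {pred freeAB} := fun x => F x == 0.
  have KE y : (y \in K) = (F y == 0) by [].
  move=> /asboolP/(_ K) xN; apply/eqP; rewrite -KE; apply: xN.
    split=> [|x1 x2]; rewrite !KE; first by rewrite -(subrr 0) FB subrr.
    by move=> /eqP x10 /eqP x20; rewrite FB x10 x20 subrr.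
  move=> y [[a [a' [b ->]]]|[a [b [b' ->]]]]; rewrite KE !FB !Fgen ?fDl ?fDr.
    by rewrite addrAC addrK subrr.
  by rewrite addrAC addrK subrr.
pose p : {additive freeAB -> tensor} := \pi_(Quotient.quot tensor_null)%qT.
have pK (q : tensor) : p (repr (q : Quotient.quot tensor_null)) = q.
  exact: (@reprK _ (Quotient.quot tensor_null)).
pose g (q : tensor) : C := F (repr (q : Quotient.quot tensor_null)).
have gp x : g (p x) = F x.
  apply/eqP; rewrite -subr_eq0 /g -FB FN// Quotient.idealrBE.
  by apply/eqP; exact: pK.
have gB : zmod_morphism g.
  by move=> u v; rewrite -{1}(pK u) -{1}(pK v) -raddfB gp FB.
pose m := GRing.isZmodMorphism.Build tensor C g gB.
pose g' : {additive tensor -> C} := HB.pack g m.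
exists g'; split=> [a b|h hE q]; first by rewrite -Fgen -gp.
rewrite -(pK q); set D := repr _; rewrite [RHS]gp -[D]freeg_sumE.
pose FL := GRing.isZmodMorphism.Build freeAB (zmodule C) F FB.
pose F' : {additive freeAB -> zmodule C} := HB.pack F FL.
rewrite -[RHS]/(F' _) !raddf_sum; apply: eq_bigr => -[a b] _.
rewrite -[coeff _ _]intz -freegU_mulz !raddfMz; congr (_ *~ _).
by rewrite [LHS]hE [RHS]Fgen.
Qed.

End Tensor.

Section DirectSum.
Variables (k : nat) (G : 'I_k -> finZmodType).

(* Indices run over 0, ..., k - 1.  The partial sum G_i + ... + G_{k-1} is
   identified with the subgroup [tail i] of the full sum, and the projection
   onto it is extended by zero. *)
Definition dirsum : finGroupType := {dffun forall j : 'I_k, G j}.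

Definition tail (i : nat) : {set dirsum} :=
  [set x : dirsum | [forall j : 'I_k, (j < i)%N ==> (x j == 0)]]%SET.

Definition proj_tail (i : nat) (x : dirsum) : dirsum :=
  [ffun j : 'I_k => if (j < i)%N then 0 else x j].

Definition m_k : nat :=
  #|[set H : {ffun 'I_k -> {group dirsum}} |
      [forall i : 'I_k, (i.+1 == k) ==> (H i == tail i :> {set dirsum})] &&
      [forall i : 'I_k, forall j : 'I_k, (j == i.+1 :> nat) ==>
        [&& H i \subset tail i,
            [set (x : dirsum) i | x in H i] == [set: G i]%SET &
            [set proj_tail j x | x in H i] \subset H j]]]%SET|.

End DirectSum.

(* 'I_n.+1 carries addition modulo n.+1, so this is Z/aZ for every a > 0;
   'Z_a would be Z/2Z for a = 1. *)
Definition Zmod (a : nat) : zmodType := 'I_a.-1.+1.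

Section Random.
Local Open Scope classical_set_scope.

(* The k-tuples of finitely generated abelian groups form a countable set up
   to isomorphism, which carries the discrete sigma-algebra: every
   isomorphism-invariant property must define an event. *)
Definition random_tuple d (T : measurableType d) (k : nat)
    (X : T -> 'I_k -> fgAbGroup) : Prop :=
  forall Q : ('I_k -> fgAbGroup) -> Prop,
    (forall A B : 'I_k -> fgAbGroup,
       (forall i, zmod_iso (A i) (B i)) -> Q A -> Q B) ->
    measurable [set w | Q (X w)].

Definition tensor_event d (T : measurableType d) (k a : nat)
    (X : T -> 'I_k -> fgAbGroup) (H : 'I_k -> finZmodType) : set T :=
  [set w | forall i, zmod_iso (tensor (X w i) (Zmod a)) (H i)].

End Random.

(* Main.v *)
From HB Require Import structures.
Require Import Defs.
From mathcomp Require Import all_boot all_order all_algebra.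
From mathcomp Require Import all_fingroup all_solvable finmap.
From mathcomp Require Import all_classical all_reals all_analysis.
From mathcomp Require Import measurable_realfun.
From mathcomp Require Import generic_quotient ring_quotient freeg.
From mathcomp Require Import zify ring lra.

(** Put [B_i := X_i (x) Z/a], so that [Sur(X_i, G) = Sur(B_i, G)] when [a] kills
    [G].  The event [B_i ~ G] is reached from [#Sur(B_i, G)] by a sieve: for one
    index [i] and one prime [p | a] at a time, keep the surjections whose kernel
    has order prime to [p].  For a surjection [f : B -> A] with kernel [K], the
    partial sums of
      [[p does not divide #K] = sum_r (-1)^r #Sur(K, F_p^r) / prod_(j < r) (p^(j+1) - 1)]
    satisfy Bonferroni inequalities, and summing [#Sur(ker f, F_p^r)] over [f]
    gives a linear combination of the moments [#Sur(B, E)], where [E] runs over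
    the extensions of [A] by [F_p^r].  Hence a sieved expectation converges, to a
    limit determined by the moments, as soon as the [r]-th term of the limiting
    series tends to [0].  The coefficients are [p^(-r^2/2 + O(r))], whereas for
    fixed other arguments [m_k(.., E, ..) <= C p^(al r^2 + be r)] with
    [al < 1/2]; sieving one index at a time is essential, since [m_k] grows
    faster than that when several arguments grow together.

    No mass escapes in the limit because
    [#Sur(B, G + F_p) = #Sur(B, G) (#Hom(B, F_p) - #Hom(G, F_p))], and
    [#Hom(B, F_p)] is large for some [p | a] when [B] is large. *)

Set Implicit Arguments.
Unset Strict Implicit.
Unset Printing Implicit Defensive.

Import Order.TTheory GRing.Theory Num.Theory FinRing.Theory.
Import numFieldNormedType.Exports.
Import mathcomp.boot.fintype mathcomp.boot.finset.
Local Open Scope ring_scope.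

(** * Homomorphisms between finite abelian groups *)

(** The Bonferroni form, rather than the exact identity, is what allows exchanging [n -> oo] with
    the sum over [r]: the error after [N] terms is at most the next term, whose expectation
    converges as well, so no uniformity in [n] is asked of the moments. Extensions are summed over
    cocycles instead of isomorphism classes: each class then enters with the right multiplicity, and
    the total is a known multiple of the sum over kernels. The bound [al < 1/2] holds for chains of
    every length because the map [al -> 1 / (4 (1 - al))] has [1/2] as its only fixed point; started
    at [0] it runs through [1/4], [1/3], [3/8], always below [1/2]. Each limit is given by a formula
    in the moments alone, so treating both sequences at once yields the equality of their limits
    together with their existence. *)

Lemma abelian_index_prime (gT : finGroupType) (G : {group gT}) (p : nat) :
  abelian G -> prime p -> (p %| #|G|)%N ->
  exists2 M : {group gT}, M \subset G & #|G : M|%g = p.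
Proof.
move=> cGG p_pr pG.
have [P sylP] := Sylow_exists p G.
have [sPG pP cardP] := and3P sylP.
have nPP : normal P P by exact: normal_refl.
have p0 := prime_gt0 p_pr.
have lP : (logn p #|P| = logn p #|G|)%N by rewrite (card_Hall sylP) logn_part.
have lG : (0 < logn p #|G|)%N by rewrite logn_gt0 mem_primes p_pr cardG_gt0.
(* The subgroup sought is [Q * K], where [Q] has index [p] in the Sylow [p]-subgroup and [K] is a
   Hall [p']-subgroup. *)
have [|Q [sQP _ cardQ]] := normal_pgroup (r := (logn p #|G|).-1) pP nPP.
  by rewrite lP leq_pred.
have [K hallK] := Hall_exists p^' (abelian_sol cGG).
have [sKG p'K _] := and3P hallK.
have sQG := subset_trans sQP sPG.
have cQK : commute Q K by apply/centC/(centSS sQG sKG).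
have gM : group_set (Q * K)%g by apply/comm_group_setP.
exists (Group gM); first by rewrite /= mul_subG.
have coQK : coprime #|Q| #|K|.
  by rewrite (pnat_coprime (pgroupS sQP pP)).
have cardM : #|Group gM| = (p ^ (logn p #|G|).-1 * (#|G|)`_p^')%N.
  by rewrite /= coprime_cardMg // cardQ (card_Hall hallK).
have cG : #|G| = (p ^ (logn p #|G|).-1 * (#|G|)`_p^' * p)%N.
  rewrite -{1}(partnC p (cardG_gt0 G)) p_part -{1}(prednK lG) expnSr.
  by rewrite -!mulnA [(p * _)%N]mulnC.
rewrite -divgS /= ?mul_subG // [#|(Q * K)%g|]cardM {1}cG mulKn //.
by rewrite muln_gt0 expn_gt0 p0 part_gt0.
Qed.

(** The quotient by [M] is cyclic of order [p]. With [x] a lift of a generator, [phi y] is the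
    discrete logarithm of [y] modulo [M]. *)
Lemma additive_to_Zp (B : finZmodType) (M : {group B}) (p : nat) :
  prime p -> #|[set: B] : M|%g = p ->
  exists2 phi : B -> 'I_p.-1.+1, {morph phi : x y / x + y}
    & forall x, (phi x == 0) = (x \in M).
Proof.
move=> p_pr iM; have p0 := prime_gt0 p_pr.
have nM x : x \in 'N(M)%g.
  by apply: (subsetP _ x (in_setT x)); rewrite sub_abelian_norm // ?subsetT // zmod_abelian.
have cardQ : #|([set: B] / M)%g| = p by rewrite card_quotient //; apply/subsetP.
have /trivgPn[q Bq q1] : ([set: B] / M)%g != 1%g.
  by apply: contraTneq p_pr => q1; rewrite -cardQ q1 cards1.
have /morphimP[x _ _ qE] := Bq.
have ordq : #[q]%g = p by apply: nt_prime_order => //; rewrite -cardQ expg_cardG.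
have cD y z : coset M (y + z) = (coset M y * coset M z)%g by rewrite -morphM ?nM.
have cX y n : coset M (y *+ n) = (coset M y ^+ n)%g by rewrite -morphX ?nM.
have cN y : coset M (- y) = (coset M y)^-1%g by rewrite -morphV ?nM.
have cosetE y z : (coset M y == coset M z) = (y - z \in M).
  apply/eqP/idP => [e|yz].
    by apply: coset_idr => //; rewrite cD cN e mulgV.
  by rewrite -{1}(subrK z y) cD coset_id ?mul1g.
have genq : <[q]>%g = ([set: B] / M)%g.
  by apply/eqP; rewrite eqEcard cycle_subG Bq /= -orderE ordq cardQ leqnn.
have ex y : exists i : 'I_p.-1.+1, y - x *+ i \in M.
  have : coset M y \in <[q]>%g by rewrite genq mem_quotient ?inE.
  case/cycleP => j e.
  have jp : (j %% p < p.-1.+1)%N by rewrite prednK // ltn_pmod.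
  by exists (Ordinal jp); rewrite -cosetE e cX -[coset M x]qE /= -expg_mod_order ordq.
have uniq (i j : 'I_p.-1.+1) y : y - x *+ i \in M -> y - x *+ j \in M -> i = j.
  rewrite -!cosetE => /eqP-> /eqP; rewrite !cX -[coset M x]qE.
  move/eqP; rewrite eq_expg_mod_order ordq !modn_small; first by move/eqP/val_inj.
    by have := ltn_ord j; rewrite {2}prednK.
  by have := ltn_ord i; rewrite {2}prednK.
pose phi y := xchoose (ex y).
have phiP y : y - x *+ phi y \in M := xchooseP (ex y).
have xpM : x *+ p \in M.
  have := cosetE (x *+ p) 0; rewrite subr0 => <-.
  by rewrite cX -[coset M x]qE -ordq expg_order -zmod1gE morph1.
have modE n : (n %% p.-1.+1 = n %% p)%N by rewrite prednK.
have Madd y z : y \in M -> z \in M -> y + z \in M by exact: groupM.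
exists phi.
  move=> y z; apply: (uniq _ _ (y + z)); first exact: phiP.
  have e : x *+ (phi y + phi z)%N - x *+ (phi y + phi z)%R \in M.
    rewrite [X in _ - X](_ : _ = x *+ ((phi y + phi z) %% p)); last by rewrite -modE.
    by rewrite {1}(divn_eq (phi y + phi z) p) mulrnDr addrK mulnC mulrnA -zmodXgE groupX.
  have -> : y + z - x *+ (phi y + phi z)%R =
     (y - x *+ phi y) + (z - x *+ phi z) + (x *+ (phi y + phi z)%N - x *+ (phi y + phi z)%R).
    rewrite mulrnDr; set a := x *+ phi y; set b := x *+ phi z; set c := x *+ _.
    by rewrite [y - a + _]addrACA -opprD addrA subrK.
  exact: Madd (Madd _ _ (phiP y) (phiP z)) e.
move=> y; apply/idP/idP => [/eqP e|yM].
  by have := phiP y; rewrite e mulr0n subr0.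
by apply/eqP; apply: (uniq _ _ y); rewrite ?phiP // mulr0n subr0.
Qed.

HB.instance Definition _ (A B : finZmodType) := GRing.Zmodule.on (A * B)%type.

Definition cyc (p : nat) : finZmodType := 'I_p.-1.+1.

Fixpoint elem (p r : nat) : finZmodType :=
  if r is r'.+1 then (elem p r' * cyc p)%type else 'I_1.

Definition homs (A B : finZmodType) : {set {ffun A -> B}} :=
  [set f : {ffun A -> B} | [forall x, forall y, f (x + y) == f x + f y]].

Definition surjs (A B : finZmodType) : {set {ffun A -> B}} :=
  [set f in homs A B | [forall y, exists x, f x == y]].

Lemma homsP (A B : finZmodType) (f : {ffun A -> B}) :
  reflect {morph f : x y / x + y} (f \in homs A B).
Proof.
rewrite inE; apply: (iffP forallP) => [fD x y|fD x].
  by have /forallP/(_ y)/eqP := fD x.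
by apply/forallP => y; rewrite fD.
Qed.

Lemma surjsP (A B : finZmodType) (f : {ffun A -> B}) :
  reflect ({morph f : x y / x + y} /\ forall y, exists x, f x = y) (f \in surjs A B).
Proof.
rewrite inE; apply: (iffP andP) => -[/homsP fD fS]; split=> //.
  by move=> y; have /forallP/(_ y)/existsP[x /eqP] := fS; exists x.
by apply/forallP => y; have [x <-] := fS y; apply/existsP; exists x.
Qed.

Section MorphAdd.
Variables (A B : zmodType) (f : A -> B).
Hypothesis fD : {morph f : x y / x + y}.

Lemma morphadd0 : f 0 = 0.
Proof. by apply: (addrI (f 0)); rewrite -fD !addr0. Qed.

Lemma morphaddN x : f (- x) = - f x.
Proof. by apply: (addrI (f x)); rewrite -fD !subrr morphadd0. Qed.

Lemma morphaddB x y : f (x - y) = f x - f y.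
Proof. by rewrite fD morphaddN. Qed.

Lemma morphaddMn x n : f (x *+ n) = f x *+ n.
Proof. by elim: n => [|n IH]; rewrite ?mulr0n ?morphadd0 // !mulrS fD IH. Qed.

End MorphAdd.

Lemma card_cyc p : prime p -> #|cyc p| = p.
Proof. by move=> /prime_gt0 p0; rewrite card_ord prednK. Qed.

Lemma cyc_gen p (c z : cyc p) : prime p -> c != 0 -> exists n, c *+ n = z.
Proof.
move=> p_pr c0.
have oc : #[c]%g = p.
  by apply: nt_prime_order;
    rewrite // -[in X in (_ ^+ X)%g](card_cyc p_pr) -cardsT expg_cardG // inE.
have : z \in <[c]>%g.
  suff -> : <[c]>%g = [set: cyc p] by rewrite inE.
  by apply/eqP; rewrite eqEcard subsetT cardsT -orderE oc (card_cyc p_pr) leqnn.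
by case/cycleP => n ->; exists n.
Qed.

Lemma card_homs_gt0 (A B : finZmodType) : (0 < #|homs A B|)%N.
Proof.
by apply/card_gt0P; exists [ffun => 0]; apply/homsP => x y; rewrite !ffunE addr0.
Qed.

Lemma card_homs_prod (A B C : finZmodType) :
  #|homs (A * B)%type C| = (#|homs A C| * #|homs B C|)%N.
Proof.
rewrite -cardsX.
pose F (f : {ffun (A * B)%type -> C}) := ([ffun x => f (x, 0)], [ffun y => f (0, y)]).
have FI : {in homs (A * B)%type C &, injective F}.
  move=> f g /homsP fD /homsP gD [/ffunP e1 /ffunP e2]; apply/ffunP => -[x y].
  have -> : (x, y) = (x, 0) + (0, y) :> (A * B)%type by congr pair; rewrite ?addr0 ?add0r.
  by have := e1 x; have := e2 y; rewrite !ffunE fD gD => -> ->.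
rewrite -(card_in_imset FI); apply/eq_card => -[u v]; rewrite in_setX /=.
apply/imsetP/andP => [[f /homsP fD [-> ->]]|[/homsP uD /homsP vD]].
  split; apply/homsP => x y; rewrite !ffunE -fD; congr (f _); congr pair; rewrite /= ?addr0 //.
exists [ffun z => u z.1 + v z.2].
  by apply/homsP => x y; rewrite !ffunE uD vD addrACA.
congr pair; apply/ffunP => x; rewrite !ffunE /=.
  by rewrite (morphadd0 vD) addr0.
by rewrite (morphadd0 uD) add0r.
Qed.

Lemma card_homs_cyc p : prime p -> #|homs (cyc p) (cyc p)| = p.
Proof.
move=> p_pr; have p0 := prime_gt0 p_pr; have p1 := prime_gt1 p_pr.
pose one : cyc p := inZp 1.
have oneE : nat_of_ord one = 1%N.
  by rewrite /= modn_small // prednK.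
have mulE (n : nat) : (n < p)%N -> nat_of_ord (one *+ n) = n.
  elim: n => [|n IH] np; first by rewrite mulr0n.
  rewrite mulrSr /= IH ?(ltnW np) // modn_small // ?prednK //.
    by rewrite modn_small ?prednK // addn1.
  by rewrite modn_small ?prednK // addn1.
have oneX (x : cyc p) : x = one *+ x.
  by apply: val_inj; rewrite /= mulE // -[X in (_ < X)%N](prednK p0).
pose F (f : {ffun cyc p -> cyc p}) := f one.
have FI : {in homs (cyc p) (cyc p) &, injective F}.
  move=> f g /homsP fD /homsP gD; rewrite /F => e; apply/ffunP => x.
  by rewrite (oneX x) !morphaddMn // e.
rewrite -(card_in_imset FI) -[RHS](card_cyc p_pr); apply/eq_card => c; rewrite [RHS]inE.
apply/imsetP; exists [ffun x : cyc p => c *+ x]; last by rewrite /F ffunE oneE.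
apply/homsP => x y; rewrite !ffunE -mulrnDr.
have cp : c *+ p = 0.
  by rewrite -[p in X in _ *+ X](card_cyc p_pr) -zmodXgE -cardsT expg_cardG // inE.
have -> : nat_of_ord (x + y) = ((x + y) %% p)%N by rewrite /= [X in (_ %% X)%N]prednK.
by rewrite [in RHS](divn_eq (x + y) p) mulrnDr mulnC mulrnA cp mul0rn add0r.
Qed.

Lemma card_homs_elem p r : prime p -> #|homs (elem p r) (cyc p)| = (p ^ r)%N.
Proof.
move=> p_pr; elim: r => [|r IH] /=; last first.
  by rewrite card_homs_prod IH card_homs_cyc // expnSr.
rewrite expn0; apply/eqP/cards1P; exists [ffun => 0]; apply/setP => f; rewrite in_set1.
apply/homsP/eqP => [fD|->]; last by move=> x y; rewrite !ffunE addr0.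
by apply/ffunP => x; rewrite ffunE (ord1 x) (morphadd0 fD).
Qed.

Lemma card_elem p r : prime p -> #|elem p r| = (p ^ r)%N.
Proof.
move=> p_pr; elim: r => [|r IH] /=; first by rewrite card_ord.
by rewrite card_prod IH card_cyc // expnSr.
Qed.

(** A surjection onto the product is a pair of a surjection [f] onto [G] and a homomorphism [phi] to
    [cyc p]. A pair fails to be onto exactly when [phi] vanishes on the kernel of [f], that is,
    factors through [f]. The surjections are the image of [u1], the failures that of [u2]. *)
Lemma card_surjs_prod_cyc (p : nat) (B G : finZmodType) : prime p ->
  (#|surjs B (G * cyc p)%type| + #|surjs B G| * #|homs G (cyc p)| =
   #|surjs B G| * #|homs B (cyc p)|)%N.
Proof.
move=> p_pr; have p0 := prime_gt0 p_pr; have p1 := prime_gt1 p_pr.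
rewrite -!cardsX.
pose u1 (u : {ffun B -> (G * cyc p)%type}) : {ffun B -> G} * {ffun B -> cyc p} :=
  ([ffun x => (u x).1], [ffun x => (u x).2]).
pose u2 (v : {ffun B -> G} * {ffun G -> cyc p}) : {ffun B -> G} * {ffun B -> cyc p} :=
  (v.1, [ffun x => v.2 (v.1 x)]).
have u1I : injective u1.
  move=> u v [/ffunP e1 /ffunP e2]; apply/ffunP => x.
  by have := e1 x; have := e2 x; rewrite !ffunE; case: (u x) (v x) => ? ? [? ?] /= -> ->.
have u2I : {in setX (surjs B G) (homs G (cyc p)) &, injective u2}.
  move=> [f l] [g m] /=; rewrite !in_setX /= => /andP[/surjsP[_ fS] _] _ [e /ffunP e2].
  subst g; congr pair; apply/ffunP => y; have [x <-] := fS y.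
  by have := e2 x; rewrite !ffunE.
rewrite -(card_imset _ u1I) -(card_in_imset u2I) -cardsUI.
rewrite [X in (_ + #|pred_of_set X|)%N](_ : _ = set0) ?cards0 ?addn0; last first.
  apply/setP => -[f phi]; rewrite in_set0;
    apply/negP => /setIP[/imsetP[u uS eu] /imsetP[[g l] gl]].
  move: uS gl => /surjsP[_ uS]; rewrite in_setX /= => /andP[/surjsP[gD _] /homsP lD] eg.
  have [x ux] := uS (0, inZp 1).
  move: eu; rewrite {}eg /u1 /u2 /= => -[/ffunP/(_ x) e1 /ffunP/(_ x)]; rewrite !ffunE /=.
  rewrite e1 ffunE ux /= (morphadd0 lD) => /(congr1 (@nat_of_ord _)) /=.
  by rewrite modn_small // prednK.
apply/eq_card => -[f phi]; rewrite in_setU in_setX /=; apply/orP/andP => [[]|].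
- move=> /imsetP[u /surjsP[uD uS] [-> ->]]; split.
    apply/surjsP; split=> [x y|y]; first by rewrite !ffunE uD.
    by have [x ux] := uS (y, 0); exists x; rewrite ffunE ux.
  by apply/homsP => x y; rewrite !ffunE uD.
- move=> /imsetP[[g l]]; rewrite in_setX /= => /andP[gS /homsP lD] [-> ->]; split=> //.
  by have [gD _] := surjsP _ gS; apply/homsP => x y; rewrite !ffunE gD lD.
move=> [/surjsP[fD fS] /homsP phiD].
have [/forallP vanish|nvanish] := boolP [forall x, (f x == 0) ==> (phi x == 0)]; [right|left].
  have fS' y : exists x, f x == y by have [x <-] := fS y; exists x.
  pose s y := xchoose (fS' y); have sK y : f (s y) = y by apply/eqP/(xchooseP (fS' y)).
  have fac x : phi (s (f x)) = phi x.
    have /implyP/(_ _)/eqP := vanish (s (f x) - x).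
    rewrite (morphaddB fD) (morphaddB phiD) sK subrr eqxx => /(_ isT) /eqP.
    by rewrite subr_eq0 => /eqP.
  apply/imsetP; exists (f, [ffun y => phi (s y)]); last first.
    by congr pair; apply/ffunP => x; rewrite !ffunE /= fac.
  rewrite in_setX /=; apply/andP; split; first by apply/surjsP.
  apply/homsP => y z; rewrite !ffunE; have [x <-] := fS y; have [x' <-] := fS z.
  by rewrite -fD !fac phiD.
(* An element of the kernel of [f] on which [phi] is nonzero corrects the second coordinate by its
   multiples without moving the first. *)
move: nvanish; rewrite negb_forall => /existsP[x0];
  rewrite negb_imply => /andP[/eqP fx0 phix0].
apply/imsetP; exists [ffun x => (f x, phi x)]; last first.
  by congr pair; apply/ffunP => x; rewrite !ffunE.
apply/surjsP; split=> [x y|[y z]]; first by rewrite !ffunE fD phiD.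
have [x fx] := fS y; have [n xn] := cyc_gen (z - phi x) p_pr phix0.
exists (x + x0 *+ n);
  rewrite ffunE fD phiD (morphaddMn fD) (morphaddMn phiD) fx0 mul0rn addr0 fx xn.
by rewrite addrC subrK.
Qed.

Lemma card_surjs_elem0 (K : finZmodType) p : #|surjs K (elem p 0)| = 1%N.
Proof.
apply/eqP/cards1P; exists [ffun => 0]; apply/setP => f; rewrite in_set1.
apply/surjsP/eqP => [_|->]; first by apply/ffunP => x; rewrite ffunE [LHS]ord1.
by split=> [x y|y]; [rewrite !ffunE addr0|exists 0; rewrite ffunE [RHS]ord1].
Qed.

Lemma card_surjs_elemS (K : finZmodType) p r : prime p ->
  (#|surjs K (elem p r.+1)| + #|surjs K (elem p r)| * p ^ r =
   #|surjs K (elem p r)| * #|homs K (cyc p)|)%N.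
Proof.
by move=> p_pr; rewrite -(card_homs_elem r p_pr); exact: card_surjs_prod_cyc.
Qed.

(* Otherwise the product [prod_(j < r) (#Hom(K, Z/p) - p ^ j)], which counts the
   surjections of [K] onto [elem p r], would be negative for some [r]. *)
Lemma card_homs_pow (K : finZmodType) p : prime p ->
  exists d, #|homs K (cyc p)| = (p ^ d)%N.
Proof.
move=> p_pr; have p1 := prime_gt1 p_pr.
set x := #|_|; have x0 : (0 < x)%N := card_homs_gt0 _ _.
have /andP[lx ux] := trunc_log_bounds p1 x0.
set d := trunc_log p x in lx ux *; exists d.
apply/eqP; rewrite eqn_leq lx andbT leqNgt; apply/negP => ltx.
have pos r : (r <= d.+1)%N -> (0 < #|surjs K (elem p r)|)%N.
  elim: r => [|r IH] rd; first by rewrite card_surjs_elem0.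
  have := card_surjs_elemS K r p_pr; have {IH} := IH (ltnW rd).
  have : (p ^ r < x)%N by apply: leq_ltn_trans ltx; rewrite leq_exp2l.
  by rewrite -/x; nia.
have := card_surjs_elemS K d.+1 p_pr; have := pos _ (leqnn _).
by rewrite -/x; move: ux; set q := (p ^ d.+1)%N; nia.
Qed.

(** The quotient by [H] is a nontrivial abelian group, so it has a subgroup of prime index, whose
    preimage serves as the kernel of [phi]. *)
Lemma exists_hom_vanishing (B : finZmodType) (H : {group B}) :
  H \proper [set: B] ->
  exists p, [/\ prime p, (p %| #|B|)%N &
    exists phi : {ffun B -> cyc p}, [/\ phi \in homs B (cyc p),
      exists x, phi x != 0 & forall x, x \in H -> phi x = 0]].
Proof.
move=> propH.
have abB := zmod_abelian [set: B].
have nHB : [set: B] \subset 'N(H)%g by rewrite sub_abelian_norm // subsetT.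
have qB1 : (1 < #|([set: B] / H)%g|)%N.
  by rewrite cardG_gt1 -subG1 quotient_sub1 //; case/andP: propH.
pose p := pdiv #|([set: B] / H)%g|; have p_pr : prime p := pdiv_prime qB1.
have [|M' sM' iM'] := abelian_index_prime (quotient_abelian H abB) p_pr.
  exact: pdiv_dvd.
pose M := (coset H @*^-1 M')%G.
have iM : #|[set: B] : M|%g = p.
  rewrite -divgS ?subsetT // card_cosetpre -iM' -divgS //.
  rewrite card_quotient // -{1}(Lagrange (subsetT H)) divnMl ?cardG_gt0 //.
have [phi phiD phiK] := additive_to_Zp p_pr iM.
exists p; split=> //.
  apply: dvdn_trans (pdiv_dvd _) _; rewrite card_quotient // -cardsT; exact: dvdn_indexg.
exists [ffun x => phi x]; split.
- by apply/homsP => x y; rewrite !ffunE phiD.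
- have /properP[_ [x _ xM]] : M \proper [set: B].
    rewrite properEneq subsetT andbT; apply: contraTneq p_pr => eM.
    by rewrite -iM eM indexgg.
  by exists x; rewrite ffunE phiK.
move=> x xH; apply/eqP; rewrite ffunE phiK.
by apply: (subsetP (sub_cosetpre _)).
Qed.

Lemma exponent_mulrn_card (B : finZmodType) (x : B) : x *+ #|B| = 0.
Proof. by rewrite -zmodXgE -cardsT expg_cardG // inE. Qed.

(** If [p] divides [#|K|], Cauchy's theorem makes multiplication by [p] non-injective, so its image
    is proper. A nonzero homomorphism vanishing on that image has values killed by [p], which forces
    its target to be [cyc p]. *)
Lemma card_homs_eq1 (K : finZmodType) p : prime p ->
  (#|homs K (cyc p)| == 1)%N = ~~ (p %| #|K|)%N.
Proof.
move=> p_pr; have p0 := prime_gt0 p_pr.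
have ccyc (c : cyc p) : c *+ p = 0.
  by rewrite -[p in X in _ *+ X](card_cyc p_pr) exponent_mulrn_card.
have ann q (phi : {ffun K -> cyc q}) : prime q -> phi \in homs K (cyc q) ->
    forall n x, coprime q n -> phi x *+ n = 0 -> phi x = 0.
  move=> q_pr _ n x cop e; apply/eqP; apply: contraTT cop => nz.
  have [m em] := cyc_gen (phi x) q_pr nz.
  have oq : #[phi x]%g = q.
    by apply: nt_prime_order;
      rewrite // -[in X in (_ ^+ X)%g](card_cyc q_pr) zmodXgE exponent_mulrn_card.
  have : (#[phi x]%g %| n)%N by rewrite order_dvdn; apply/eqP.
  by rewrite oq prime_coprime // => ->.
have one0 : [ffun => 0] \in homs K (cyc p) by apply/homsP => x y; rewrite !ffunE addr0.
apply/idP/idP => [/cards1P[f0 e]|pK]; last first.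
  apply/cards1P; exists [ffun => 0]; apply/setP => f; rewrite in_set1.
  apply/idP/eqP => [fH|-> //]; apply/ffunP => x; rewrite ffunE.
  apply: (ann _ _ p_pr fH #|K|); first by rewrite prime_coprime.
  by have /homsP fD := fH; rewrite -(morphaddMn fD) exponent_mulrn_card (morphadd0 fD).
apply/negP => pK.
have gS : group_set [set x *+ p | x : K].
  apply/group_setP; split; first by apply/imsetP; exists 0; rewrite // mul0rn.
  by move=> _ _ /imsetP[x _ ->] /imsetP[y _ ->]; apply/imsetP; exists (x + y);
    rewrite ?mulrnDl.
have prop : Group gS \proper [set: K].
  rewrite properEcard subsetT ltn_neqAle subset_leq_card ?subsetT // andbT cardsT /=.
  apply/negP => /imset_injP inj.
  have [|z _ oz] := @Cauchy _ p [set: K]%G p_pr; first by rewrite cardsT.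
  have : z = 0.
    apply: inj; rewrite ?inE // mul0rn -zmodXgE -oz; exact: expg_order.
  by move=> z0; move: p_pr; rewrite -oz z0 order1.
have [q [q_pr _ [phi [phiH [x phix] phi0]]]] := exists_hom_vanishing prop.
have /homsP phiD := phiH.
have [qp|qp] := eqVneq q p.
  subst q; move: phiH one0; rewrite e !in_set1 => /eqP ephi /eqP/ffunP/(_ x).
  by rewrite -ephi ffunE => e0; rewrite -e0 eqxx in phix.
case/negP: phix; apply/eqP; apply: (ann _ _ q_pr phiH p).
  by rewrite prime_coprime // dvdn_prime2.
by rewrite -(morphaddMn phiD); apply: phi0; apply/imsetP; exists x.
Qed.

(** * Bonferroni inequalities for divisibility by a prime *)

Section Bonferroni.
Variable R : realFieldType.

(** Since [#GL_r(F_p) = p ^ (r (r - 1) / 2) * prod_(j < r) (p ^ (j + 1) - 1)], the coefficient times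
    [#Sur(K, F_p^r)] is [p ^ (r (r - 1) / 2)] times the number of subgroups of [K] with quotient
    [F_p^r]. With the sign [(-1) ^ r] this is Moebius inversion on a lattice of subspaces. *)
Definition bonf_coef (p r : nat) : R := (\prod_(j < r) (p%:R ^+ j.+1 - 1))^-1.

Lemma card_surjs_elemE (K : finZmodType) p r : prime p ->
  #|surjs K (elem p r)|%:R = \prod_(j < r) (#|homs K (cyc p)|%:R - p%:R ^+ j) :> R.
Proof.
move=> p_pr; elim: r => [|r IH]; first by rewrite card_surjs_elem0 big_ord0.
rewrite big_ord_recr /= -IH mulrBr -natrX -!natrM -card_surjs_elemS //.
by rewrite natrD addrK.
Qed.

Lemma bonferroni_surjs (K : finZmodType) p N : prime p ->
  `|(~~ (p %| #|K|)%N)%:R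
     - \sum_(r < N.+1) (-1) ^+ r * (bonf_coef p r * #|surjs K (elem p r)|%:R)|
  <= bonf_coef p N.+1 * #|surjs K (elem p N.+1)|%:R :> R.
Proof.
move=> p_pr; rewrite card_surjs_elemE //; set x := #|homs K _|%:R.
under eq_bigr do rewrite card_surjs_elemE // -/x.
have p1 (j : nat) : 0 < p%:R ^+ j.+1 - 1 :> R.
  by rewrite subr_gt0 exprn_egt1 // ltr1n prime_gt1.
pose P n := \prod_(j < n) ((x - p%:R ^+ j.+1) / (p%:R ^+ j.+1 - 1)) : R.
have tE n : bonf_coef p n.+1 * \prod_(j < n.+1) (x - p%:R ^+ j) =
    P n * ((x - 1) / (p%:R ^+ n.+1 - 1)).
  rewrite /bonf_coef /P big_split /= prodfV big_ord_recr /= [X in _ * X = _]big_ord_recl expr0.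
  rewrite invfM /=; set A := \prod_(i < n) _; set C := \prod_(i < n) _; ring.
(* The alternating sums telescope. For [x = p ^ d], the product [P N] is [(-1) ^ N] if [d = 0],
   vanishes if [1 <= d <= N], and otherwise is nonnegative and at most the next term, because then
   [x - 1 >= p ^ (N + 1) - 1]. *)
have sumE n : \sum_(r < n.+1) (-1) ^+ r * (bonf_coef p r * \prod_(j < r) (x - p%:R ^+ j)) =
    (-1) ^+ n * P n.
  elim: n => [|n IH].
    by rewrite big_ord_recr big_ord0 /= /bonf_coef /P !big_ord0 invr1 !mulr1 add0r.
  rewrite big_ord_recr /= {}IH tE /P [in RHS]big_ord_recr /= -/(P n) exprS.
  by field; rewrite gt_eqF.
rewrite sumE tE -(card_homs_eq1 K p_pr).
have [d dE] := card_homs_pow K p_pr.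
have xE : x = p%:R ^+ d by rewrite /x dE natrX.
case: d dE xE => [|d] dE xE; rewrite dE.
  rewrite xE expr0 subrr mul0r mulr0 /= /P xE expr0.
  rewrite (eq_bigr (fun=> -1)); last first.
    by move=> i _; rewrite -opprB mulNr divff // gt_eqF.
  by rewrite prodr_const card_ord -exprMn mulrNN mulr1 expr1n subrr normr0.
rewrite -[1%N](expn0 p) eqn_exp2l ?prime_gt1 //= sub0r normrN normrM normrX normrN1 expr1n mul1r.
have [dN|Nd] := ltnP d N.
  have -> : P N = 0.
    by apply/eqP; rewrite prodf_seq_eq0; apply/hasP; exists (Ordinal dN);
      rewrite ?mem_index_enum //= xE subrr mul0r.
  by rewrite normr0 mul0r.
have P0 : 0 <= P N.
  apply: prodr_ge0 => j _; apply: divr_ge0; last exact: ltW.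
  rewrite xE subr_ge0 ler_weXn2l ?ler1n ?prime_gt0 //.
  by rewrite (leq_trans (ltn_ord j)) // (leq_trans Nd).
rewrite ger0_norm // ler_peMr // ler_pdivlMr // mul1r lerD2r xE.
by rewrite ler_weXn2l ?ler1n ?prime_gt0.
Qed.

End Bonferroni.

(** * Counting surjections onto extensions *)

Section Kernel.
Variables (B A : finZmodType) (f : {ffun B -> A}).

(* When [f] is not additive this is the zero subgroup, so that [kert f] is a
   group for every finite function [f]. *)
Definition kpred : {pred B} := fun x => (x == 0) || ((f \in homs B A) && (f x == 0)).

Lemma kpredE x : (x \in kpred) = (x == 0) || ((f \in homs B A) && (f x == 0)).
Proof. by []. Qed.

Lemma kpred_closed : zmod_closed kpred.
Proof.
split=> [|x y]; first by rewrite kpredE eqxx.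
rewrite !kpredE; case: (boolP (f \in homs B A)) => [/homsP fD|_] /=; last first.
  by rewrite !orbF => /eqP-> /eqP->; rewrite subrr.
have K z : (z == 0) || (f z == 0) -> f z = 0.
  by case/orP => /eqP-> //; exact: morphadd0.
by move=> /K fx /K fy; rewrite (morphaddB fD) fx fy subrr eqxx orbT.
Qed.

HB.instance Definition _ := GRing.isZmodClosed.Build B kpred kpred_closed.

Definition kert := {x : B | x \in kpred}.
HB.instance Definition _ := Finite.on kert.
HB.instance Definition _ := SubType.on kert.
HB.instance Definition _ := [SubChoice_isSubZmodule of kert by <:].

Lemma mem_kpred x : f \in homs B A -> (x \in kpred) = (f x == 0).
Proof.
move=> fH; rewrite kpredE fH /=; case: eqP => [->|//].
by move/homsP: fH => /morphadd0->; rewrite eqxx.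
Qed.

Lemma kert0 (k : kert) : f \in homs B A -> f (val k) = 0.
Proof. by move=> fH; apply/eqP; rewrite -mem_kpred //; exact: valP. Qed.

Lemma surj_section : f \in surjs B A -> exists s : A -> B, cancel s f.
Proof.
move=> /surjsP[_ fS]; have ex y : exists x, f x == y by have [x <-] := fS y; exists x.
by exists (fun y => xchoose (ex y)) => y; apply/eqP/(xchooseP (ex y)).
Qed.

Lemma card_kert : f \in surjs B A -> #|B| = (#|A| * #|{: kert}|)%N.
Proof.
move=> fS; have [fD _] := surjsP _ fS; have fH := introT (homsP _) fD.
have [s sK] := surj_section fS.
have kk x : x - s (f x) \in kpred by rewrite mem_kpred // (morphaddB fD) sK subrr.
rewrite -card_prod; apply/esym/(@bij_eq_card _ _ (fun u : A * kert => s u.1 + val u.2)).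
exists (fun x => (f x, Sub (x - s (f x)) (kk x) : kert)) => [[a k]|x] /=;
  last by rewrite addrC subrK.
have e : f (s a + val k) = a by rewrite fD sK kert0 // addr0.
by congr pair => //; apply: val_inj; rewrite /= e addrC addKr.
Qed.

End Kernel.

(** Symmetry makes the extension commutative. The cocycles are not normalized at [0]: this leaves
    the values of a lift on a section entirely free and gives the clean factor [#V ^ #A], at the
    price of the zero element [(0, - c (0, 0))]. *)
Definition is_cocycle (A V : finZmodType) (c : {ffun A * A -> V}) : bool :=
  [forall x, forall y, c (x, y) == c (y, x)] &&
  [forall x, forall y, forall z, c (x, y) + c (x + y, z) == c (y, z) + c (x, y + z)].

Definition cocycle (A V : finZmodType) := {c : {ffun A * A -> V} | is_cocycle c}.

Lemma cocycleP (A V : finZmodType) (c : {ffun A * A -> V}) :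
  reflect ((forall x y, c (x, y) = c (y, x)) /\
           forall x y z, c (x, y) + c (x + y, z) = c (y, z) + c (x, y + z)) (is_cocycle c).
Proof.
apply: (iffP andP) => -[c1 c2]; split.
- by move=> x y; have /forallP/(_ x)/forallP/(_ y)/eqP := c1.
- by move=> x y z; have /forallP/(_ x)/forallP/(_ y)/forallP/(_ z)/eqP := c2.
- by apply/forallP => x; apply/forallP => y; rewrite c1.
- by apply/forallP => x; apply/forallP => y; apply/forallP => z; rewrite c2.
Qed.

Definition coc (A V : finZmodType) (c : cocycle A V) (x y : A) : V := val c (x, y).
Arguments coc : simpl never.

Definition ext (A V : finZmodType) (c : cocycle A V) : Type := (A * V)%type.

Section Extension.
Variables (A V : finZmodType) (c : cocycle A V).

HB.instance Definition _ := Finite.on (ext c).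

Let cC x y : coc c x y = coc c y x.
Proof. by have /cocycleP[eC _] := valP c; rewrite /coc eC. Qed.
Let cA x y z : coc c x y + coc c (x + y) z = coc c y z + coc c x (y + z).
Proof. by have /cocycleP[_ eA] := valP c; rewrite /coc eA. Qed.

Definition ext_add (u v : ext c) : ext c := (u.1 + v.1, u.2 + v.2 + coc c u.1 v.1).
Definition ext_zero : ext c := (0, - coc c 0 0).
Definition ext_opp (u : ext c) : ext c :=
  (- u.1, - u.2 - coc c u.1 (- u.1) - coc c 0 0).

Lemma cocycle0r x : coc c x 0 = coc c 0 0.
Proof. by have := cA x 0 0; rewrite !addr0 => /addIr. Qed.

Lemma ext_addA : associative ext_add.
Proof.
move=> u v w; rewrite /ext_add /= addrA; congr pair.
transitivity (u.2 + v.2 + w.2 + (coc c v.1 w.1 + coc c u.1 (v.1 + w.1))).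
  by rewrite !addrA.
by rewrite -cA !addrA; congr (_ + _); rewrite addrAC.
Qed.

Lemma ext_addC : commutative ext_add.
Proof. by move=> u v; rewrite /ext_add addrC cC [u.2 + _]addrC. Qed.

Lemma ext_add0 : left_id ext_zero ext_add.
Proof.
move=> [x v]; rewrite ext_addC /ext_add /ext_zero /= addr0; congr pair.
by rewrite cocycle0r subrK.
Qed.

Lemma ext_addN : left_inverse ext_zero ext_opp ext_add.
Proof.
move=> [x v]; rewrite ext_addC /ext_add /ext_zero /ext_opp /= subrr; congr pair.
set a := coc c _ _; set b := coc c _ _.
transitivity ((v - v) + (a - a) - b); last by rewrite !subrr !add0r.
rewrite -!addrA; congr (_ + (_ + _)); rewrite [RHS]addrCA; congr (_ + _).
exact: addrC.
Qed.

HB.instance Definition _ := GRing.isZmodule.Build (ext c) ext_addA ext_addC ext_add0 ext_addN.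

Lemma card_ext : #|{: ext c}| = (#|A| * #|V|)%N.
Proof. exact: card_prod. Qed.

End Extension.

Lemma sum_card_pairs (I J : finType) (S : I -> {set J}) :
  (\sum_i #|S i| = #|[set u : I * J | u.2 \in S u.1]|)%N.
Proof.
rewrite -sum1_card (eq_bigr (fun i => \sum_(j | j \in S i) 1)%N); last first.
  by move=> i _; rewrite sum1_card.
by rewrite pair_big_dep /=; apply: eq_bigl => u; rewrite inE.
Qed.

Section CountExtensions.
Variables (B A V : finZmodType).

Definition fst_part (f : {ffun B -> A}) (c : cocycle A V) :=
  [set g in surjs B (ext c) | [ffun x => (g x).1] == f].

(** A lift of [f] to the extension is determined by its second coordinate, which is additive up to
    the cocycle; these functions are easier to count than the lifts, as their type does not depend
    on [c]. *)
Definition twisted (f : {ffun B -> A}) (c : cocycle A V) : {set {ffun B -> V}} :=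
  [set [ffun x => (g x).2] | g : {ffun B -> ext c} in fst_part f c].

Lemma card_twisted f c : #|twisted f c| = #|fst_part f c|.
Proof.
apply: card_in_imset => g h; rewrite !inE => /andP[_ /eqP eg] /andP[_ /eqP eh].
move=> /ffunP e; apply/ffunP => x; move: (e x); rewrite !ffunE.
have : (g x).1 = (h x).1 by move: eg; rewrite -eh => /ffunP/(_ x); rewrite !ffunE.
by case: (g x) (h x) => a b [a' b'] /= -> ->.
Qed.

Lemma twistedP (f : {ffun B -> A}) (c : cocycle A V) (t : {ffun B -> V}) :
  f \in homs B A ->
  reflect ((forall x y, t (x + y) = t x + t y + coc c (f x) (f y)) /\
           forall a v, exists x, f x = a /\ t x = v) (t \in twisted f c).
Proof.
move=> /homsP fD; apply: (iffP imsetP) => [[g]|[tD tS]].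
  rewrite inE => /andP[/surjsP[gD gS] /eqP fE] ->.
  have fg x : f x = (g x).1 by rewrite -fE ffunE.
  split=> [x y|a v]; first by rewrite !ffunE gD !fg.
  by have [x gx] := gS (a, v); exists x; rewrite fg ffunE gx.
exists [ffun x => (f x, t x) : ext c]; last by apply/ffunP => x; rewrite !ffunE.
rewrite inE; apply/andP; split; last by apply/eqP/ffunP => x; rewrite !ffunE.
apply/surjsP; split=> [x y|[a v]]; first by rewrite !ffunE fD tD.
by have [x [fx tx]] := tS a v; exists x; rewrite ffunE fx tx.
Qed.

(* As [f] is onto, [t] determines the cocycle [c]; and [t] amounts to its values
   on a section of [f] together with a homomorphism from [kert f] to [V]. *)
Lemma card_twisted_sum (f : {ffun B -> A}) : f \in surjs B A ->
  (\sum_c #|twisted f c| = #|V| ^ #|A| * #|surjs (kert f) V|)%N.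
Proof.
move=> fS; have [fD _] := surjsP _ fS; have fH := introT (homsP _) fD.
have [s sK] := surj_section fS.
have KE x : (x \in kpred f) = (f x == 0) by exact: mem_kpred.
rewrite sum_card_pairs -card_ffun -cardsT -cardsX.
(* On the kernel of [f] the function [t] is additive up to the constant [c (0, 0)]; adding that
   constant makes it a homomorphism. *)
pose Fwd (u : cocycle A V * {ffun B -> V}) : {ffun A -> V} * {ffun kert f -> V} :=
  ([ffun a => u.2 (s a)], [ffun k => u.2 (val k) + coc u.1 0 0]).
have tdec c t x : t \in twisted f c ->
    t x = t (s (f x)) + (t (x - s (f x)) + coc c 0 0).
  move=> /(twistedP _ _ fH)[tD _]; rewrite -{1}(subrK (s (f x)) x) addrC tD.
  by rewrite (morphaddB fD) !sK subrr cocycle0r addrA.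
rewrite -(card_in_imset (f := Fwd)); last first.
  move=> [c t] [c' t']; rewrite !inE /= => tT tT' [/ffunP e1 /ffunP e2].
  have kk x : x - s (f x) \in kpred f by rewrite KE (morphaddB fD) sK subrr.
  have tt' : t =1 t'.
    move=> x; rewrite (tdec _ _ x tT) (tdec _ _ x tT').
    have := e1 (f x); rewrite !ffunE => ->; congr (_ + _).
    by have := e2 (Sub (x - s (f x)) (kk x)); rewrite !ffunE.
  congr pair; last exact/ffunP.
  apply/val_inj/ffunP => -[a b].
  have [tD _] := twistedP _ _ fH tT; have [tD' _] := twistedP _ _ fH tT'.
  have := tD (s a) (s b); rewrite !tt' tD' !sK => /addrI.
  by rewrite /coc => ->.
apply/eq_card => -[tau psi]; rewrite in_setX in_setT /=; apply/imsetP/idP.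
  move=> [[c t]]; rewrite inE /= => /(twistedP _ _ fH)[tD tS] [_ ->].
  apply/surjsP; split=> [x y|v].
    by rewrite !ffunE /= tD !kert0 // addrACA -!addrA; congr (_ + _); rewrite addrA.
  have [x [fx tx]] := tS 0 (v - coc c 0 0).
  have xK : x \in kpred f by rewrite KE fx.
  by exists (Sub x xK); rewrite ffunE /= tx subrK.
move=> /surjsP[psiD psiS].
pose ps (x : B) : V := psi (insubd 0 x).
have psE (k : kert f) : ps (val k) = psi k by rewrite /ps valKd.
have psD x y : f x = 0 -> f y = 0 -> ps (x + y) = ps x + ps y.
  move=> /eqP fx /eqP fy; rewrite -KE in fx; rewrite -KE in fy.
  by have := psiD (Sub x fx) (Sub y fy); rewrite -!psE /= => <-.
have ps0 : ps 0 = 0 by apply: (addrI (ps 0)); rewrite -psD ?addr0 ?(morphadd0 fD).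
pose t x := tau (f x) + ps (x - s (f x)).
have tk x k : f k = 0 -> t (x + k) = t x + ps k.
  move=> fk; rewrite /t fD fk addr0 -[RHS]addrA; congr (_ + _).
  by rewrite -psD ?(morphaddB fD) ?sK ?subrr // addrAC.
have ts a : t (s a) = tau a by rewrite /t sK subrr ps0 addr0.
(* The cocycle is forced: it measures the failure of [t] to be additive on the section. Its
   identities come from commutativity and associativity in [B], the second by expanding
   [t (s a + s b + s z)] in two ways. *)
pose cf (a b : A) := t (s a + s b) - t (s a) - t (s b).
have tD x y : t (x + y) = t x + t y + cf (f x) (f y).
  have k0 z : f (z - s (f z)) = 0 by rewrite (morphaddB fD) sK subrr.
  have tz z : t z = t (s (f z)) + ps (z - s (f z)).
    by rewrite -tk // addrC subrK.
  rewrite [t x]tz [t y]tz /cf.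
  have -> : x + y = s (f x) + s (f y) + ((x - s (f x)) + (y - s (f y))).
    by rewrite addrACA ![s _ + _]addrC !subrK.
  have kxy : f ((x - s (f x)) + (y - s (f y))) = 0 by rewrite (fD (_ - _)) !k0 addr0.
  rewrite (tk _ _ kxy) psD //.
  set p1 := ps _; set p2 := ps _; set t1 := t (s _); set t2 := t (s _); set t3 := t _.
  transitivity (t1 + t2 + (t3 - t1 - t2) + (p1 + p2));
    last by rewrite addrAC [t1 + t2 + _]addrACA.
  by congr (_ + _); rewrite addrC -(addrA t3) -opprD subrK.
have cfE a b : cf a b = t (s a + s b) - t (s a) - t (s b) by [].
clearbody cf t.
have cfC : is_cocycle [ffun u => cf u.1 u.2].
  apply/cocycleP; split=> [a b|a b z]; rewrite !ffunE /=.
    by rewrite !cfE [s a + _]addrC addrAC.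
  apply: (addrI (t (s a) + t (s b) + t (s z))).
  transitivity (t (s a + (s b + s z))); last by rewrite !tD !fD !sK !addrA.
  by rewrite [s a + _]addrA !tD !fD !sK addrA; congr (_ + _); exact: addrAC.
exists (Sub [ffun u => cf u.1 u.2] cfC, finfun t).
  rewrite inE /=; apply/(twistedP _ _ fH); split=> [x y|a v].
    by rewrite !ffunE tD /coc /= ffunE.
  have [k kE] := psiS (v - tau a).
  exists (s a + val k); rewrite ffunE tk ?kert0 // ts psE kE fD kert0 // addr0 sK.
  by rewrite addrC subrK.
congr pair; apply/ffunP => x; rewrite !ffunE ?ts //= /coc /= ffunE /=.
have fx : f (\val x) = 0 by exact: kert0.
rewrite -psE cfE.
have -> : t (val x) = t (s 0) + ps (val x - s 0).
  by rewrite -tk ?(morphaddB fD) ?fx ?sK ?subrr // addrC subrK.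
rewrite tk ?sK //.
have -> : ps (val x) = ps (val x - s 0) + ps (s 0).
  by rewrite -psD ?(morphaddB fD) ?fx ?sK ?subrr // subrK.
rewrite [t (s 0) + ps (s 0)]addrC addrK [ps (s 0) - _]addrC addrA; congr (_ + _).
by rewrite addrAC subrr add0r.
Qed.

(** The first coordinate of a surjection onto an extension of [A] is a surjection onto [A], and the
    surjections are grouped by it. Read from right to left, the formula turns a count over kernels
    into ordinary moments. *)
Lemma sum_card_surjs_ext :
  (\sum_(c : cocycle A V) #|surjs B (ext c)| =
   #|V| ^ #|A| * \sum_(f in surjs B A) #|surjs (kert f) V|)%N.
Proof.
rewrite big_distrr /= -(eq_bigr _ (fun f fS => card_twisted_sum fS)) exchange_big /=.
apply: eq_bigr => c _; under [RHS]eq_bigr do rewrite card_twisted.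
rewrite -sum1_card (partition_big (fun g : {ffun B -> ext c} => [ffun x => (g x).1])
  (fun f => f \in surjs B A)) /=.
  by apply: eq_bigr => f _; rewrite -sum1_card; apply: eq_bigl => g; rewrite [RHS]inE.
move=> g /surjsP[gD gS]; apply/surjsP; split=> [x y|a]; first by rewrite !ffunE gD.
by have [x gx] := gS (a, 0); exists x; rewrite ffunE gx.
Qed.

End CountExtensions.

Definition vanishing (B : finZmodType) (H : {set B}) (p : nat) :=
  [set phi in homs B (cyc p) | [forall x in H, phi x == 0]].

(* Each step of the induction adjoins to [H] an element on which some
   homomorphism vanishing on [H] is nonzero, which removes it from the count. *)
Lemma card_le_vanishing (B : finZmodType) (a n : nat) (H : {group B}) :
  (0 < a)%N -> (forall x : B, x *+ a = 0) ->
  (\sum_(p <- primes a) #|vanishing H p| <= n)%N -> (#|B| <= #|H| * a ^ n)%N.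
Proof.
move=> a0 aB; elim: n H => [|n IH] H; have := subsetT H;
  rewrite subEproper => /orP[/eqP-> _|propH Hn].
- by rewrite cardsT expn0 muln1.
- have [p [p_pr pB [phi [phiH [x phix] phi0]]]] := exists_hom_vanishing propH.
  exfalso; move: Hn; rewrite leqn0 sum_nat_seq_eq0 => /allP Hn.
  have pa : p \in primes a.
    rewrite mem_primes p_pr a0 /=.
    have [|z _ oz] := @Cauchy _ p [set: B]%G p_pr; first by rewrite cardsT.
    by rewrite -oz order_dvdn zmodXgE aB.
  have := Hn p pa; rewrite /= cards_eq0 => /eqP/setP/(_ phi).
  by rewrite in_set0 inE phiH /= => /negP; apply; apply/forall_inP => y /phi0->.
- by rewrite cardsT leq_pmulr // expn_gt0 a0.
have [p [p_pr pB [phi [phiH [x phix] phi0]]]] := exists_hom_vanishing propH.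
have pa : p \in primes a.
  rewrite mem_primes p_pr a0 /=.
  have [|z _ oz] := @Cauchy _ p [set: B]%G p_pr; first by rewrite cardsT.
  by rewrite -oz order_dvdn zmodXgE aB.
pose H' := (H <*> <[x]>)%G.
have sHH' : H \subset H' by exact: joing_subl.
have xH' : x \in H' by rewrite (subsetP (joing_subr _ _)) // cycle_id.
have le1 q : (#|vanishing H' q| <= #|vanishing H q|)%N.
  apply/subset_leq_card/subsetP => f; rewrite !inE => /andP[-> /forall_inP f0] /=.
  by apply/forall_inP => y yH; apply: f0; apply: (subsetP sHH').
have lt1 : (#|vanishing H' p| < #|vanishing H p|)%N.
  apply/proper_card/properP; split.
    apply/subsetP => f; rewrite !inE => /andP[-> /forall_inP f0] /=.
    by apply/forall_inP => y yH; apply: f0; apply: (subsetP sHH').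
  exists phi; first by rewrite in_set phiH /=; apply/forall_inP => y /phi0->.
  by rewrite in_set phiH /=; apply/negP => /forall_inP/(_ x xH'); apply/negP.
have lt2 : (\sum_(q <- primes a) #|vanishing H' q| < \sum_(q <- primes a) #|vanishing H q|)%N.
  rewrite (bigD1_seq p) ?primes_uniq //= [X in (_ < X)%N](bigD1_seq p) ?primes_uniq //=.
  by rewrite -addSn leq_add // leq_sum.
have {}IH := IH H' (leq_trans lt2 Hn).
apply: leq_trans IH _; rewrite expnS mulnA leq_mul2r; apply/orP; right.
have -> : H' = (H * <[x]>)%g :> {set B}.
  rewrite /= norm_joinEr //; apply: subset_trans (subsetT _) _.
  by apply: sub_abelian_norm; rewrite ?zmod_abelian ?subsetT.
apply: (@leq_trans (#|H| * #|<[x]>%g|)%N).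
  by rewrite mul_cardG leq_pmulr // cardG_gt0.
rewrite leq_mul2l dvdn_leq ?orbT // -orderE order_dvdn; by rewrite zmodXgE aB.
Qed.

Lemma card_le_homs (B : finZmodType) (a : nat) :
  (0 < a)%N -> (forall x : B, x *+ a = 0) ->
  (#|B| <= a ^ (\sum_(p <- primes a) #|homs B (cyc p)|))%N.
Proof.
move=> a0 aB; rewrite -[X in (_ <= X)%N]mul1n -(cards1 (1%g : B)).
apply: (@card_le_vanishing B a _ 1%G) => //.
by apply: leq_sum => p _; apply/subset_leq_card/subsetP => f; rewrite inE => /andP[].
Qed.

(** * Growth of the moments *)

Section SubgroupCount.
Local Open Scope nat_scope.

Definition subgroups_logn (gT : finGroupType) (G : {set gT}) (p h : nat) :=
  [set H : {group gT} | (H \subset G) && (logn p #|H| == h)].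

Section CountOutside.
Variables (gT : finGroupType) (G M : {group gT}) (p : nat).
Hypotheses (abG : abelian G) (p_pr : prime p) (sMG : M \subset G) (iM : #|G : M|%g = p).

Lemma card_subgroup_outside (H : {group gT}) : H \subset G -> ~~ (H \subset M) ->
  #|H| = p * #|H :&: M| /\ (M * H = G)%g.
Proof.
move=> sHG nHM.
have maxM : maximal M G by apply: p_index_maximal => //; rewrite iM.
have comm : commute M H by apply/centC/(centSS sMG sHG).
have eMH : (M * H)%g = G.
  have gMH : group_set (M * H)%g by apply/comm_group_setP.
  have [_ maxP] := maxgroupP maxM.
  apply/eqP; rewrite eqEproper mul_subG //=; apply/negP => prop.
  have := maxP (Group gMH) prop (mulG_subl _ _) => /= e.
  by move/negP: nHM; apply; rewrite -e mulG_subr.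
split=> //; have := mul_cardG M H; rewrite eMH -(Lagrange sMG) iM -mulnA => /eqP.
by rewrite eqn_pmul2l ?cardG_gt0 // setIC => /eqP.
Qed.

(** As [M * H = G], each such [H] meets the coset of [M] through a fixed [y] outside [M], in a coset
    of [K]. This intersection determines [H]: any point of it generates [H] together with [K],
    because [K] has prime index in [H]. *)
Lemma card_subgroups_outside (K : {group gT}) : K \subset M ->
  #|[set H : {group gT} | [&& H \subset G, ~~ (H \subset M) & H :&: M == K :> {set gT}]]|
    <= #|M : K|%g.
Proof.
move=> sKM; set S := [set H : {group gT} | _].
have [y yG yM] : exists2 y, y \in G & y \notin M.
  by apply/subsetPn; apply/negP => sGM; move: p_pr;
    rewrite -iM (eqP (_ : #|G : M|%g == 1)) // indexg_eq1.
have sec H : H \in S -> exists2 x, x \in H & x \in (M :* y)%g.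
  rewrite inE => /and3P[sHG nHM _]; have [_ eG] := card_subgroup_outside sHG nHM.
  have : y \in (M * H)%g by rewrite eG.
  case/mulsgP => m x mM xH ->; exists x => //.
  by rewrite mem_rcoset invMg mulKVg; apply: groupVr.
pose F (H : {group gT}) := H :&: (M :* y)%g.
have FI : {in S &, injective F}.
  move=> H1 H2 S1 S2 e; have [x x1 xMy] := sec H1 S1.
  have x2 : x \in H2.
    have : x \in F H2 by rewrite -e in_setI x1.
    by rewrite in_setI => /andP[].
  have xM : x \notin M.
    apply: contra yM => xM; move: xMy; rewrite mem_rcoset => e1.
    by rewrite -groupV -(mulKg x y^-1%g) groupM // groupV.
  have gen H : H \in S -> x \in H -> (K <*> <[x]>)%g = H :> {set gT}.
    rewrite inE => /and3P[sHG nHM /eqP eK] xH.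
    have [cH _] := card_subgroup_outside sHG nHM.
    have sKH : K \subset H by rewrite -eK subsetIl.
    have maxK : maximal K H.
      apply: p_index_maximal => //; rewrite -divgS // cH eK mulnK ?cardG_gt0 //.
    have [_ maxP] := maxgroupP maxK.
    apply/eqP; rewrite eqEproper join_subG sKH cycle_subG xH /=; apply/negP => prop.
    have := maxP (K <*> <[x]>)%G prop (joing_subl _ _) => /= e2.
    have : x \in K by rewrite -e2 (subsetP (joing_subr _ _)) // cycle_id.
    by move/(subsetP sKM); apply/negP.
  by apply/val_inj; rewrite /= -(gen H1) // -(gen H2).
rewrite -(card_in_imset FI).
apply: leq_trans (leq_imset_card (fun C : {set gT} => (C :* y)%g) (mem (rcosets K M))).
apply/subset_leq_card/subsetP => _ /imsetP[H HS ->].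
have [x xH xMy] := sec H HS; have := HS; rewrite inE => /and3P[sHG _ /eqP eK].
apply/imsetP; exists (K :* (x * y^-1))%g.
  by apply/rcosetsP; exists (x * y^-1)%g => //; move: xMy; rewrite mem_rcoset.
rewrite -rcosetM mulgKV /F -eK; apply/setP => z.
rewrite in_setI !mem_rcoset in_setI.
apply/andP/andP => [[zH zM]|[zH zM]].
  rewrite groupM ?groupV //; split=> //.
  have -> : (z * x^-1 = (z * y^-1) * (x * y^-1)^-1)%g by rewrite invMg invgK mulgA mulgKV.
  by rewrite groupM // groupV; move: xMy; rewrite mem_rcoset.
split; first by rewrite -(mulgKV x z) groupM.
have -> : (z * y^-1 = (z * x^-1) * (x * y^-1))%g by rewrite mulgA mulgKV.
by rewrite groupM //; move: xMy; rewrite mem_rcoset.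
Qed.

End CountOutside.

(* The recursion is that of the Gaussian binomials: fix [M] of index [p] and
   split the subgroups [H] of [G] according to whether [H] lies in [M]; when it
   does not, [H] is determined by [H :&: M] and a coset of it. *)
Lemma card_subgroups_le (gT : finGroupType) (G : {group gT}) (p h c : nat) :
  abelian G -> prime p -> (#|G|)`_p^' <= c ->
  #|subgroups_logn G p h| <=
    2 ^ c * (2 * c) ^ logn p #|G| * p ^ (h * (logn p #|G| - h)).
Proof.
move=> abG p_pr cG; have p0 := prime_gt0 p_pr.
have lpp : logn p p = 1 by rewrite logn_prime // eqxx.
have c0 : 0 < c by apply: leq_trans cG; exact: part_gt0.
move ev : (logn p #|G|) => v; elim: v G abG cG h ev => [|v IH] G abG cG h ev.
  have cG1 : #|G| <= c.
    by move: cG; rewrite -{2}(partnC p (cardG_gt0 G)) p_part ev mul1n.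
  rewrite expn0 muln1 (leq_trans (n := 2 ^ c)) ?leq_pmulr ?expn_gt0 ?p0 //.
  apply: leq_trans (_ : #|powerset G| <= _); last by rewrite card_powerset leq_exp2l.
  rewrite -(card_imset _ (@group_inj gT)); apply/subset_leq_card/subsetP.
  by move=> _ /imsetP[H + ->]; rewrite !inE => /andP[].
have pG : p %| #|G|.
  have : p \in primes #|G| by rewrite -logn_gt0 ev.
  by rewrite mem_primes => /and3P[].
have [M sMG iM] := abelian_index_prime abG p_pr pG.
have cardG : #|G| = #|M| * p by rewrite -(Lagrange sMG) iM.
have lM : logn p #|M| = v.
  by move: ev; rewrite cardG lognM ?cardG_gt0 // lpp addn1 => -[].
have cM : (#|M|)`_p^' <= c.
  apply: leq_trans cG; rewrite cardG partnM ?cardG_gt0 //.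
  by rewrite leq_pmulr // part_gt0.
have abM := abelianS sMG abG.
pose Out := [set H : {group gT} | [&& H \subset G, ~~ (H \subset M) & logn p #|H| == h]].
have split_le : #|subgroups_logn G p h| <= #|subgroups_logn M p h| + #|Out|.
  apply: leq_trans (leq_card_setU _ _); apply/subset_leq_card/subsetP => H.
  by rewrite !inE => /andP[sHG ->]; rewrite sHG !andbT; case: (H \subset M).
apply: leq_trans split_le _; have IH1 := IH M abM cM h lM.
case: h => [|h] in Out IH1 *.
  rewrite [X in _ + X](_ : _ = 0) ?addn0; last first.
    apply/eqP; rewrite cards_eq0; apply/eqP/setP => H; rewrite !inE.
    apply/negP => /and3P[sHG nHM];
      have [cH _] := card_subgroup_outside abG p_pr sMG iM sHG nHM.
    by rewrite cH lognM ?cardG_gt0 // lpp.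
  rewrite mul0n in IH1 *; apply: leq_trans IH1 _.
  by rewrite leq_mul2r leq_mul2l leq_pexp2l ?orbT //; rewrite muln_gt0 c0.
have IH2 := IH M abM cM h lM.
have fib (K : {group gT}) : K \in subgroups_logn M p h ->
    #|[set H in Out | H :&: M == K :> {set gT}]| <= c * p ^ (v - h).
  rewrite inE => /andP[sKM /eqP lK].
  apply: leq_trans (_ : #|M : K|%g <= _).
    apply: leq_trans (card_subgroups_outside abG p_pr sMG iM sKM).
    apply/subset_leq_card/subsetP => H; rewrite !inE.
    by case/andP => /and3P[-> -> _] ->.
  have hv : h <= v by rewrite -lK -lM dvdn_leq_log ?cardG_gt0 // cardSg.
  have := Lagrange sKM;
    rewrite -(partnC p (cardG_gt0 M)) -(partnC p (cardG_gt0 K)) !p_part lM lK.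
  rewrite -[X in _ = p ^ X * _](subnKC hv) expnD -!mulnA => /eqP;
    rewrite eqn_pmul2l ?expn_gt0 ?p0 // => /eqP e.
  rewrite [c * _]mulnC (leq_trans (n := p ^ (v - h) * (#|M|)`_p^')) //;
    last by rewrite leq_mul2l cM orbT.
  by rewrite -e leq_pmull // part_gt0.
have outE : #|Out| <= #|subgroups_logn M p h| * (c * p ^ (v - h)).
  rewrite -sum1_card (partition_big (fun H : {group gT} => (H :&: M)%G) (mem (subgroups_logn M p h))) /=; last first.
    move=> H; rewrite !inE => /and3P[sHG nHM /eqP lH]; rewrite subsetIr /=.
    have [cH _] := card_subgroup_outside abG p_pr sMG iM sHG nHM.
    by move: lH; rewrite cH lognM ?cardG_gt0 // lpp add1n => -[->].
  rewrite -sum_nat_const; apply: leq_sum => K KM.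
  apply: leq_trans (fib K KM); rewrite -sum1_card; rewrite leq_eqVlt; apply/orP; left;
    apply/eqP.
  by apply: eq_bigl => H; rewrite [in RHS]inE; congr (_ && _).
have [hv|vh] := ltnP v h.
  have z : #|subgroups_logn M p h| = 0.
    apply/eqP; rewrite cards_eq0; apply/eqP/setP => K; rewrite !inE.
    apply/negP => /andP[sKM /eqP lK].
    by move: hv; rewrite -lK -lM ltnNge dvdn_leq_log ?cardG_gt0 // cardSg.
  move: outE; rewrite z mul0n leqn0 => /eqP->; rewrite addn0.
  apply: leq_trans IH1 _; apply: leq_mul;
    last by rewrite leq_pexp2l // leq_mul2l leq_sub2r ?orbT.
  by rewrite leq_mul2l leq_pexp2l ?orbT //; rewrite muln_gt0 c0.
set D := 2 ^ c * (2 * c) ^ v in IH1 IH2 *.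
rewrite expnS.
have eq1 : p ^ (h.+1 * (v.+1 - h.+1)) = p ^ (h * (v - h)) * p ^ (v - h).
  by rewrite subSS mulSn addnC expnD.
have le1 : p ^ (h.+1 * (v - h.+1)) <= p ^ (h.+1 * (v.+1 - h.+1)).
  by rewrite leq_pexp2l // leq_mul2l leq_sub2r ?orbT.
(* In the factor [2 * c] gained here, [c] bounds the prime-to-[p] part of the index of [K] in [M],
   and [2] accounts for the two kinds of [H]. *)
have -> : 2 ^ c * (2 * c * (2 * c) ^ v) * p ^ (h.+1 * (v.+1 - h.+1)) =
    c * (D * p ^ (h.+1 * (v.+1 - h.+1))) + c * (D * p ^ (h.+1 * (v.+1 - h.+1))).
  by rewrite /D; set q := p ^ _; set d := (2 * c) ^ v; set e := 2 ^ c; nia.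
apply: leq_add.
  apply: leq_trans IH1 _; rewrite -[X in X <= _]mul1n leq_mul // leq_mul //.
apply: leq_trans outE _; rewrite eq1 mulnCA leq_mul2l; apply/orP; right.
by rewrite mulnA leq_mul2r IH2 orbT.
Qed.

(* [chain_count ok n K] counts the chains [H_0, ..., H_n = K] with
   [ok i H_i H_(i+1)]. *)
Fixpoint chain_count (T : finType) (ok : nat -> rel T) (n : nat) (K : T) : nat :=
  if n is n'.+1 then \sum_(H | ok n' H K) chain_count ok n' H else 1.

Lemma card_chains (T : finType) (ok : nat -> rel T) (n : nat) (K : T) :
  #|[set H : {ffun 'I_n.+1 -> T} | (H ord_max == K) &&
     [forall i : 'I_n, ok i (H (widen_ord (leqnSn n) i)) (H (lift ord0 i))]]|
  <= chain_count ok n K.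
Proof.
elim: n K => [|n IH] K /=.
  rewrite (leq_trans (subset_leq_card (_ : _ \subset [set [ffun=> K]]))) ?cards1 //.
  apply/subsetP => H; rewrite !inE => /andP[/eqP HK _]; apply/eqP/ffunP => i.
  by rewrite ffunE -HK; congr (H _); apply: val_inj; rewrite /= (ord1 i).
set S := [set H | _].
pose low : 'I_n.+2 := widen_ord (leqnSn n.+1) ord_max.
rewrite -sum1_card (partition_big (fun H : {ffun 'I_n.+2 -> T} => H low) (fun L => ok n L K)) /=; last first.
  move=> H; rewrite inE => /andP[/eqP HK /forallP/(_ ord_max)].
  by rewrite (_ : lift ord0 ord_max = ord_max) ?HK //; apply: val_inj.
apply: leq_sum => L okL; apply: leq_trans (IH L).
rewrite sum1_card.
pose F (H : {ffun 'I_n.+2 -> T}) : {ffun 'I_n.+1 -> T} := [ffun i => H (widen_ord (leqnSn n.+1) i)].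
have FI : {in [pred H | (H \in S) && (H low == L)] &, injective F}.
  move=> H H'; rewrite !inE => /andP[/andP[/eqP HK _] _] /andP[/andP[/eqP HK' _] _] /ffunP e.
  apply/ffunP => i; have [ilt|ige] := ltnP i n.+1.
    have := e (Ordinal ilt); rewrite !ffunE (_ : widen_ord _ _ = i) //; exact: val_inj.
  have -> : i = ord_max by apply: val_inj; apply/eqP; rewrite /= eqn_leq ige -ltnS ltn_ord.
  by rewrite HK HK'.
rewrite -(card_in_imset FI); apply/subset_leq_card/subsetP => _ /imsetP[H + ->].
rewrite !inE => /andP[/andP[_ /forallP Hok] /eqP HL]; rewrite ffunE HL eqxx /=.
apply/forallP => i; have := Hok (widen_ord (leqnSn n) i); rewrite !ffunE /=.
rewrite (_ : widen_ord _ (lift ord0 i) = lift ord0 (widen_ord (leqnSn n) i)) //.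
exact: val_inj.
Qed.

End SubgroupCount.

(** * Chains of subgroups counted by [m_k] *)

Section Chains.
Variables (k : nat) (G : 'I_k.+1 -> finZmodType).
Notation D := (dirsum G).

Lemma dirsum_abelian (A : {set D}) : abelian A.
Proof.
apply/centsP => x _ y _; apply/ffunP => i; rewrite !mulg_ffun.
exact: zmod_mulgC.
Qed.

Lemma proj_tailM n : {morph @proj_tail k.+1 G n : x y / (x * y)%g}.
Proof.
move=> x y; apply/ffunP => j; rewrite mulg_ffun !ffunE; case: ifP => // _.
by rewrite zmodMgE addr0.
Qed.

Lemma mem_tail n (x : D) : (x \in tail G n) = [forall j : 'I_k.+1, (j < n)%N ==> (x j == 0)].
Proof. by rewrite inE. Qed.

Lemma tailP n (x : D) : reflect (forall j : 'I_k.+1, (j < n)%N -> x j = 0) (x \in tail G n).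
Proof.
rewrite mem_tail; apply: (iffP forallP) => [xT j jn|xT j];
  first by have /implyP/(_ jn)/eqP := xT j.
by apply/implyP => jn; rewrite xT.
Qed.

Lemma tail_group_set n : group_set (tail G n).
Proof.
apply/group_setP; split; first by apply/tailP => j _; rewrite oneg_ffun.
move=> x y /tailP xT /tailP yT; apply/tailP => j jn.
by rewrite mulg_ffun xT // yT // zmodMgE addr0.
Qed.

Definition tail_group n : {group D} := Group (tail_group_set n).

(** Every [H] that precedes [K] in a chain lies in this group, whose order is known when [K] lies in
    the next tail. Counting the possible [H] becomes counting subgroups of one abelian group. *)
Definition step_group_set n (K : {group D}) : {set D} :=
  [set x in tail G n | proj_tail n.+1 x \in K].

Lemma step_group_groupset n K : group_set (step_group_set n K).
Proof.
have in_step x : (x \in step_group_set n K) = (x \in tail_group n) && (proj_tail n.+1 x \in K).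
  by rewrite in_set.
apply/group_setP; split.
  rewrite in_step group1 (_ : proj_tail n.+1 1%g = 1%g) ?group1 //.
  by apply/ffunP => j; rewrite ffunE !oneg_ffun; case: ifP.
move=> x y; rewrite !in_step => /andP[xT xK] /andP[yT yK].
by rewrite groupM // proj_tailM groupM.
Qed.

Definition step_group n K : {group D} := Group (step_group_groupset n K).

Lemma in_step_group n K x :
  (x \in step_group n K) = (x \in tail G n) && (proj_tail n.+1 x \in K).
Proof. by rewrite in_set. Qed.

Lemma card_tail n : #|tail G n| = (\prod_(j < k.+1) if (j < n)%N then 1 else #|G j|)%N.
Proof.
rewrite (_ : tail G n = setXn (fun j : 'I_k.+1 => if (j < n)%N then [set 0 : G j]%SET else [set: G j]%SET)).
  by rewrite cardsXn; apply: eq_bigr => j _; case: ifP; rewrite ?cards1 ?cardsT.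
apply/setP => x; rewrite in_setXn mem_tail; apply: eq_forallb => j.
by case: ifP; rewrite ?inE.
Qed.

Lemma card_step_group (i : 'I_k.+1) (K : {group D}) : K \subset tail G i.+1 ->
  #|step_group i K| = (#|G i| * #|K|)%N.
Proof.
move=> sKT.
have ltS (j : 'I_k.+1) : (j < i.+1)%N -> j != i -> (j < i)%N.
  by rewrite ltnS leq_eqVlt -val_eqE => /orP[->|].
pose F (x : D) : G i * D := (x i, proj_tail i.+1 x).
have FI : {in step_group i K &, injective F}.
  move=> x y; rewrite !in_step_group => /andP[/tailP xT _] /andP[/tailP yT _] [e1 /ffunP e2].
  apply/ffunP => j; have [->//|ji] := eqVneq j i.
  have [jlt|jge] := ltnP j i; first by rewrite xT // yT.
  have := e2 j; rewrite !ffunE; case: ifP => // jlt.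
  by move: jge; rewrite leqNgt ltS.
rewrite -(card_in_imset FI) -[#|G i|]cardsT -cardsX; apply/eq_card => -[g y].
rewrite in_setX in_setT /=; apply/imsetP/idP => [[x + [_ ->]]|yK].
  by rewrite in_step_group => /andP[].
have /tailP yT := subsetP sKT y yK.
exists (dfung1 g * y)%g.
  rewrite in_step_group; apply/andP; split.
    apply/tailP => j ji; rewrite mulg_ffun yT ?ltnS ?(ltnW ji) //.
    by rewrite dfung1_dflt ?zmodMgE ?addr0 // -val_eqE /= gtn_eqF.
  suff -> : proj_tail i.+1 (dfung1 g * y)%g = y by [].
  apply/ffunP => j; rewrite ffunE; case: ifP => [/yT->//|ji].
  by rewrite mulg_ffun dfung1_dflt ?mul1g // -val_eqE /=; apply: contraFneq ji => ->;
    rewrite ltnS.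
congr pair; first by rewrite mulg_ffun dfung1_id yT // zmodMgE addr0.
apply/ffunP => j; rewrite ffunE; case: ifP => [/yT->//|ji].
by rewrite mulg_ffun dfung1_dflt ?mul1g // -val_eqE /=; apply: contraFneq ji => ->;
  rewrite ltnS.
Qed.

Definition chain_ok (n : nat) (H K : {group D}) : bool :=
  [&& H \subset tail G n,
      [set (x : D) (inord n : 'I_k.+1) | x in H] == [set: G (inord n)] &
      [set proj_tail n.+1 x | x in H] \subset K].

Lemma m_k_le_chain_count : (m_k G <= chain_count chain_ok k (tail_group k))%N.
Proof.
apply: leq_trans (card_chains _ _ _); apply/subset_leq_card/subsetP => H.
rewrite !inE => /andP[/forallP top /forallP H_ok]; apply/andP; split.
  by have /implyP/(_ (eqxx _)) := top ord_max; rewrite -val_eqE.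
apply/forallP => i; have /forallP/(_ (lift ord0 i)) := H_ok (widen_ord (leqnSn k) i).
rewrite /= /bump /= add1n eqxx /= /chain_ok.
by rewrite (_ : inord i = widen_ord (leqnSn k) i) //; apply: val_inj;
  rewrite /= inordK // ltnS ltnW.
Qed.

Lemma chain_ok_step n (H K : {group D}) : chain_ok n H K -> H \subset step_group n K.
Proof.
case/and3P => sHT _ sHK; apply/subsetP => x xH; rewrite in_step_group (subsetP sHT) //=.
by apply: (subsetP sHK); apply/imsetP; exists x.
Qed.

(** The surjectivity of [H] onto its own summand enters the growth estimates only through this lower
    bound on [#|H|]; it keeps [al] unchanged when a chain passes the modified index. *)
Lemma chain_ok_dvd n (H K : {group D}) : chain_ok n H K -> (#|G (inord n)| %| #|H|)%N.
Proof.
case/and3P => _ /eqP eH _; rewrite -cardsT -eH.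
have -> : [set (x : D) (inord n : 'I_k.+1) | x in H] = (dffun_morphism G (inord n) @* H)%g.
  by rewrite morphimEsub ?subsetT.
exact: dvdn_morphim.
Qed.

End Chains.

Definition update (k : nat) (G : 'I_k -> finZmodType) (i0 : 'I_k) (E : finZmodType)
  : 'I_k -> finZmodType := fun j => if j == i0 then E else G j.

(** * Bounds with quadratic exponents *)

Section Growth.
Variables (R : realType) (p : nat).
Hypothesis p_pr : prime p.

Definition rpow (x : R) : R := expR (x * ln p%:R).

Let lnp : 0 <= ln (p%:R : R).
Proof. by rewrite ln_ge0 // ler1n prime_gt0. Qed.

Lemma rpowD x y : rpow (x + y) = rpow x * rpow y.
Proof. by rewrite /rpow mulrDl expRD. Qed.

Lemma rpow_gt0 x : 0 < rpow x.
Proof. exact: expR_gt0. Qed.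

Lemma rpow_ge0 x : 0 <= rpow x.
Proof. exact/ltW/rpow_gt0. Qed.

Lemma ler_rpow x y : x <= y -> rpow x <= rpow y.
Proof. by move=> xy; rewrite ler_expR ler_wpM2r. Qed.

Lemma rpow_nat n : rpow n%:R = (p ^ n)%N%:R.
Proof.
by rewrite /rpow expRM_natl lnK ?natrX // posrE ltr0n prime_gt0.
Qed.

Lemma logn_le_card n : (logn p n <= n)%N.
Proof.
have [->|n0] := posnP n; first by rewrite logn0.
apply: leq_trans (ltnW (ltn_expl (logn p n) (prime_gt1 p_pr))) _.
by rewrite dvdn_leq // pfactor_dvdnn.
Qed.

(** A shift of the variable by [s] costs a constant factor and a larger linear coefficient, but
    leaves the quadratic coefficient [al] alone. *)
Lemma rpow_quad_shift (al be s m v : R) : 0 <= al -> 0 <= be ->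
  0 <= s -> 0 <= v -> 0 <= m -> m <= v + s ->
  rpow (al * m ^+ 2 + be * m) <=
  rpow (al * s ^+ 2 + be * s) * rpow (al * v ^+ 2 + (be + 2 * al * s) * v).
Proof.
move=> al0 be0 s0 v0 m0 mv; rewrite -rpowD; apply: ler_rpow.
have m2 : m ^+ 2 <= (v + s) ^+ 2 by rewrite ler_sqr // nnegrE addr_ge0.
have := ler_wpM2l al0 m2; have := ler_wpM2l be0 mv; nra.
Qed.

Section Step.
Variables (k : nat) (G : 'I_k.+1 -> finZmodType) (c0 : nat).
Hypothesis c0P : ((#|dirsum G|)`_p^' <= c0)%N.
Notation D := (dirsum G).

(** The subgroups [H] are sorted by the exponent [h] of [p] in their order, and each class is
    bounded by counting subgroups of the step group. The [m + 1] values of [h] and the factor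
    [(2 * c0) ^ m] are absorbed in an exponential linear in [m], so any quadratic exponent sits in
    [T]. *)
Lemma sum_chain_ok_le (i : 'I_k.+1) (K : {group D}) (F : nat -> R) (T : R) :
  K \subset tail G i.+1 -> (forall h, 0 <= F h) ->
  let m := (logn p #|G i| + logn p #|K|)%N in
  (forall h, (logn p #|G i| <= h <= m)%N -> (p ^ (h * (m - h)))%N%:R * F h <= T) ->
  \sum_(H | chain_ok i H K) F (logn p #|H|) <=
  (2 ^ c0)%N%:R * rpow ((2 * c0 + 1)%N%:R * m%:R) * T.
Proof.
move=> sKT F0 m FT; set g := logn p #|G i| in m FT *.
have cS : #|step_group i K| = (#|G i| * #|K|)%N by exact: card_step_group.
have Gi0 : (0 < #|G i|)%N by apply/card_gt0P; exists 0.
have lS : logn p #|step_group i K| = m by rewrite cS lognM ?cardG_gt0.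
have pS : ((#|step_group i K|)`_p^' <= c0)%N.
  apply: leq_trans c0P; rewrite dvdn_leq ?part_gt0 // partn_dvd //.
    by rewrite -cardsT cardG_gt0.
  by rewrite -cardsT cardSg // subsetT.
have ok_lb (H : {group D}) : chain_ok i H K -> (g <= logn p #|H| <= m)%N.
  move=> okH; rewrite -lS; apply/andP; split; apply: dvdn_leq_log; rewrite ?cardG_gt0 //.
    by have := chain_ok_dvd okH; rewrite inord_val.
  exact/cardSg/chain_ok_step.
rewrite (partition_big (fun H : {group D} => inord (logn p #|H|) : 'I_m.+1)
   (fun h : 'I_m.+1 => (g <= h)%N)) /=; last first.
  by move=> H /ok_lb /andP[gH Hm]; rewrite inordK.
have T0 : 0 <= T.
  by apply: le_trans (FT g _); rewrite ?mulr_ge0 // leqnn leq_addr.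
apply: (@le_trans _ _ (\sum_(h < m.+1) (2 ^ c0 * (2 * c0) ^ m)%N%:R * T)); last first.
  rewrite big_const_ord iter_addr_0 natrM -[_ *+ m.+1]mulr_natl.
  set A := (2 ^ c0)%N%:R; set C := ((2 * c0) ^ m)%N%:R.
  have -> : m.+1%:R * (A * C * T) = A * (m.+1%:R * C) * T by rewrite !mulrA (mulrC A).
  rewrite ler_wpM2r // ler_wpM2l // -!natrM rpow_nat ler_nat.
  rewrite mulnDl mul1n expnD mulnC expnM leq_mul //; last exact: ltn_expl (prime_gt1 p_pr).
  case: (m) => // m'; rewrite leq_exp2r //.
  exact: ltnW (ltn_expl _ (prime_gt1 p_pr)).
rewrite big_mkcond /=; apply: ler_sum => h _; case: ifP => [gh|_]; last by rewrite mulr_ge0.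
have hm : (h <= m)%N by rewrite -ltnS.
apply: (@le_trans _ _ (\sum_(H in subgroups_logn (step_group i K) p h) F h)).
  rewrite [leLHS]big_mkcond [leRHS]big_mkcond /=; apply: ler_sum => H _.
  case: ifP => [/andP[okH /eqP hE]|_]; last by case: ifP => // _; exact: F0.
  have /andP[gH Hm] := ok_lb _ okH.
  have {}hE : logn p #|H| = h by rewrite -hE inordK.
  by rewrite inE chain_ok_step //= hE eqxx.
rewrite sumr_const -[leLHS]mulr_natl.
have abS : abelian (step_group i K) by exact: dirsum_abelian.
have := card_subgroups_le h abS p_pr pS; rewrite lS => cnt.
apply: (@le_trans _ _ ((2 ^ c0 * (2 * c0) ^ m * p ^ (h * (m - h)))%N%:R * F h)).
  by rewrite ler_wpM2r // ler_nat.
by rewrite natrM -mulrA ler_wpM2l // FT // gh.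
Qed.

End Step.

Section GrowthUpdate.
Variables (k : nat) (G : 'I_k.+1 -> finZmodType) (i0 : 'I_k.+1) (c : nat).

Let T : nat := \prod_j #|G j|.
Let c0 := (c * T)%N.

Let card_G_gt0 (A : finZmodType) : (0 < #|A|)%N.
Proof. by apply/card_gt0P; exists 0. Qed.

Lemma card_update_neq (E : finZmodType) (j : 'I_k.+1) : j != i0 -> #|update G i0 E j| = #|G j|.
Proof. by move=> ji; rewrite /update (negbTE ji). Qed.

Lemma update_eq (E : finZmodType) : update G i0 E i0 = E.
Proof. by rewrite /update eqxx. Qed.

Lemma part_card_dirsum_update (E : finZmodType) :
  ((#|E|)`_p^' <= c)%N -> ((#|dirsum (update G i0 E)|)`_p^' <= c0)%N.
Proof.
move=> Ec.
have partP (F : 'I_k.+1 -> nat) : (forall j, 0 < F j)%N ->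
    ((\prod_j F j)`_p^' = \prod_j (F j)`_p^')%N.
  move=> F0; suff [] : (0 < \prod_j F j /\ (\prod_j F j)`_p^' = \prod_j (F j)`_p^')%N by [].
  elim/big_rec2: _ => [|j x y _ [x0 <-]]; first by rewrite partn1.
  by rewrite muln_gt0 F0 x0 partnM.
rewrite card_dep_ffun foldrE big_map big_enum /=.
rewrite (partP (fun j => #|update G i0 E j|)) => [|j]; last exact: card_G_gt0.
rewrite /c0 /T (bigD1 i0) //= update_eq leq_mul //.
rewrite [leqRHS](bigD1 i0) //= -[leqLHS]mul1n leq_mul //.
apply: leq_prod => j ji; rewrite card_update_neq //; apply: dvdn_leq (dvdn_part _ _).
exact: card_G_gt0.
Qed.

(* Since [h (m - h) + al h^2 <= m^2 / (4 (1 - al))], one more subgroup in the chain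
   changes [al] into [1 / (4 (1 - al))], which remains below [1 / 2]. *)
Lemma chain_count_below (n : nat) : (n <= i0)%N ->
  exists al be C : R, [/\ 0 <= al < 1 / 2, 0 <= be, 0 <= C &
    forall E : finZmodType, ((#|E|)`_p^' <= c)%N ->
    forall K : {group dirsum (update G i0 E)}, K \subset tail (update G i0 E) n ->
      (chain_count (@chain_ok _ (update G i0 E)) n K)%:R <=
      C * rpow (al * (logn p #|K|)%:R ^+ 2 + be * (logn p #|K|)%:R)].
Proof.
elim: n => [|n IH] ni.
  exists 0, 0, 1; split=> //; first by apply/andP; split=> //; lra.
  by move=> E _ K _; rewrite !mul0r addr0 mul1r -[0](mulr0n 1) rpow_nat expn0.
have [al [be [C [/andP[al0 al1] be0 C0 cnt]]]] := IH (ltnW ni).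
have nk : (n < k.+1)%N by apply: ltn_trans ni (ltn_ord i0).
pose i : 'I_k.+1 := Ordinal nk.
have ii0 : i != i0 by rewrite -val_eqE /= ltn_eqF.
pose al' : R := (4 * (1 - al))^-1.
have al'0 : 0 <= al' by rewrite invr_ge0; lra.
have al'1 : al' < 1 / 2.
  by rewrite /al' -div1r ltr_pdivrMr; lra.
pose g : R := (logn p #|G i|)%:R.
pose b : R := (2 * c0 + 1)%N%:R.
have g0 : 0 <= g by [].
have b0 : 0 <= b by [].
exists al', (be + b + 2 * al' * g), ((2 ^ c0)%N%:R * C * rpow (al' * g ^+ 2 + (be + b) * g)).
split=> //; first by rewrite al'0.
- by rewrite !addr_ge0 // !mulr_ge0.
- by rewrite !mulr_ge0 // rpow_ge0.
move=> E Ec K sKT /=; rewrite natr_sum.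
pose F (h : nat) := C * rpow (al * h%:R ^+ 2 + be * h%:R).
apply: (@le_trans _ _ (\sum_(H | chain_ok n H K) F (logn p #|H|))).
  by apply: ler_sum => H /and3P[sHT _ _]; apply: cnt.
have Fpos h : 0 <= F h by rewrite mulr_ge0 // rpow_ge0.
have := @sum_chain_ok_le _ _ c0 (part_card_dirsum_update Ec) i K F
  (C * rpow (al' * (logn p #|G i| + logn p #|K|)%N%:R ^+ 2 + be * (logn p #|G i| + logn p #|K|)%N%:R))
  sKT Fpos.
rewrite card_update_neq //=; set m := (logn p #|G i| + logn p #|K|)%N => /(_ _) step.
apply: (le_trans (step _)).
  move=> h /andP[_ hm]; rewrite /F mulrCA ler_wpM2l // -rpow_nat -rpowD; apply: ler_rpow.
  have hmR : h%:R <= m%:R :> R by rewrite ler_nat.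
  rewrite natrM natrB //.
  (* The square to be completed: [h (m - h) + al h ^ 2] is largest at [h = m / (2 (1 - al))]. *)
  have key : (1 - al) * (h%:R - m%:R * (2 * (1 - al))^-1) ^+ 2 >= 0 :> R.
    by rewrite mulr_ge0 ?sqr_ge0 //; lra.
  have := ler_wpM2l be0 hmR.
  have e : h%:R * (m%:R - h%:R) + al * h%:R ^+ 2 =
     al' * m%:R ^+ 2 - (1 - al) * (h%:R - m%:R * (2 * (1 - al))^-1) ^+ 2 :> R.
    by rewrite /al'; field; lra.
  by lra.
have mE : m%:R = (logn p #|K|)%:R + g :> R by rewrite /m natrD addrC.
have sh : rpow (al' * m%:R ^+ 2 + (be + b) * m%:R) <= rpow (al' * g ^+ 2 + (be + b) * g) *
  rpow (al' * (logn p #|K|)%:R ^+ 2 + (be + b + 2 * al' * g) * (logn p #|K|)%:R).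
  by apply: rpow_quad_shift; rewrite ?addr_ge0 // mE.
rewrite -/b; apply: le_trans (_ : (2 ^ c0)%N%:R * C * rpow (al' * m%:R ^+ 2 + (be + b) * m%:R) <= _).
  rewrite (_ : al' * m%:R ^+ 2 + (be + b) * m%:R = b * m%:R + (al' * m%:R ^+ 2 + be * m%:R)); last by ring.
  by rewrite (rpowD (b * m%:R)) !mulrA [X in X * _ <= _]mulrAC.
by rewrite -[leRHS]mulrA ler_wpM2l // mulr_ge0.
Qed.

Lemma card_tail_update (E : finZmodType) (n : nat) : (i0 < n)%N ->
  (#|tail (update G i0 E) n| <= T)%N.
Proof.
move=> in0; rewrite card_tail; apply: leq_prod => j _; case: ltnP => [_|nj].
  exact: card_G_gt0.
by rewrite card_update_neq // -val_eqE /= gtn_eqF // (leq_trans in0).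
Qed.

(** Past [i0] the tails no longer contain the summand [E], so [K] has bounded order and the estimate
    is in terms of [E] instead. The step crossing [i0] keeps [al], and each later one multiplies the
    count by at most [2 ^ T]. *)
Lemma chain_count_above (n : nat) : (i0 < n)%N -> (n <= k)%N ->
  exists al be C : R, [/\ 0 <= al < 1 / 2, 0 <= be, 0 <= C &
    forall E : finZmodType, ((#|E|)`_p^' <= c)%N ->
    forall K : {group dirsum (update G i0 E)}, K \subset tail (update G i0 E) n ->
      (chain_count (@chain_ok _ (update G i0 E)) n K)%:R <=
      C * rpow (al * (logn p #|E|)%:R ^+ 2 + be * (logn p #|E|)%:R)].
Proof.
elim: n => // n IH; rewrite ltnS leq_eqVlt => /orP[/eqP i0n|i0n] nk; last first.
  have [al [be [C [al01 be0 C0 cnt]]]] := IH i0n (ltnW nk).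
  exists al, be, ((2 ^ T)%N%:R * C); split=> //; first by rewrite mulr_ge0.
  move=> E Ec K sKT /=; rewrite natr_sum -mulrA; set B := C * _.
  have B0 : 0 <= B by rewrite mulr_ge0 // rpow_ge0.
  apply: (@le_trans _ _ (\sum_(H in [pred H | chain_ok n H K]) B)).
    by apply: ler_sum => H /and3P[sHT _ _]; apply: cnt.
  rewrite sumr_const -[leLHS]mulr_natl ler_wpM2r // ler_nat.
  apply: (@leq_trans #|powerset (step_group n K)|); last first.
    rewrite card_powerset leq_exp2l // (leq_trans _ (card_tail_update E i0n)) //.
    by apply/subset_leq_card/subsetP => x; rewrite in_step_group => /andP[].
  rewrite -(card_imset _ (@group_inj _)); apply/subset_leq_card/subsetP.
  by move=> _ /imsetP[H + ->]; rewrite powersetE inE => /chain_ok_step.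
have [al [be [C [/andP[al0 al1] be0 C0 cnt]]]] := chain_count_below (leqnn i0).
subst n; pose b : R := (2 * c0 + 1)%N%:R; have b0 : 0 <= b by [].
pose t : R := T%:R; have t0 : 0 <= t by [].
exists al, (be + b + t + 2 * al * t), ((2 ^ c0)%N%:R * C * rpow (al * t ^+ 2 + (be + b + t) * t)).
split=> //; first by rewrite al0.
- by rewrite !addr_ge0 // !mulr_ge0.
- by rewrite !mulr_ge0 // rpow_ge0.
move=> E Ec K sKT /=; rewrite natr_sum.
pose F (h : nat) := C * rpow (al * h%:R ^+ 2 + be * h%:R).
apply: (@le_trans _ _ (\sum_(H | chain_ok i0 H K) F (logn p #|H|))).
  by apply: ler_sum => H /and3P[sHT _ _]; apply: cnt.
have Fpos h : 0 <= F h by rewrite mulr_ge0 // rpow_ge0.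
have KT : (logn p #|K| <= T)%N.
  apply: leq_trans (logn_le_card _) _.
  by apply: leq_trans (subset_leq_card sKT) (card_tail_update E _).
pose m := (logn p #|E| + logn p #|K|)%N.
have := @sum_chain_ok_le _ _ c0 (part_card_dirsum_update Ec) i0 K F
  (C * rpow (al * m%:R ^+ 2 + (be + t) * m%:R)) sKT Fpos.
rewrite update_eq -/m => /(_ _) step.
apply: (le_trans (step _)).
  move=> h /andP[rh hm]; rewrite /F mulrCA ler_wpM2l // -rpow_nat -rpowD; apply: ler_rpow.
  have hmR : h%:R <= m%:R :> R by rewrite ler_nat.
  have h2 : h%:R ^+ 2 <= m%:R ^+ 2 :> R by rewrite ler_sqr ?nnegrE.
  (* As [h] is at least the exponent of [p] in [#|E|], the difference [m - h] is at most that in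
     [#|K|], hence at most [T]: the term [h (m - h)] is only linear in [m]. *)
  have hmT : (h * (m - h))%:R <= t * m%:R :> R.
    rewrite /t -natrM ler_nat mulnC leq_mul // (leq_trans _ KT) //.
    by rewrite /m leq_subLR leq_add2r.
  have := ler_wpM2l al0 h2; have := ler_wpM2l be0 hmR; lra.
have mE : m%:R <= (logn p #|E|)%:R + t :> R by rewrite /t -natrD ler_nat leq_add2l.
have sh : rpow (al * m%:R ^+ 2 + (be + b + t) * m%:R) <= rpow (al * t ^+ 2 + (be + b + t) * t) *
  rpow (al * (logn p #|E|)%:R ^+ 2 + (be + b + t + 2 * al * t) * (logn p #|E|)%:R).
  by apply: rpow_quad_shift; rewrite ?addr_ge0.
rewrite -/b; apply: le_trans (_ : (2 ^ c0)%N%:R * C * rpow (al * m%:R ^+ 2 + (be + b + t) * m%:R) <= _).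
  rewrite (_ : al * m%:R ^+ 2 + (be + b + t) * m%:R = b * m%:R + (al * m%:R ^+ 2 + (be + t) * m%:R)); last by ring.
  by rewrite (rpowD (b * m%:R)) !mulrA [X in X * _ <= _]mulrAC.
by rewrite -[leRHS]mulrA ler_wpM2l // mulr_ge0.
Qed.

Lemma m_k_growth :
  exists al be C : R, [/\ 0 <= al < 1 / 2, 0 <= be, 0 <= C &
    forall E : finZmodType, ((#|E|)`_p^' <= c)%N ->
      (m_k (update G i0 E))%:R <=
      C * rpow (al * (logn p #|E|)%:R ^+ 2 + be * (logn p #|E|)%:R)].
Proof.
have [i0k|ki0] := ltnP i0 k.
  have [al [be [C [al01 be0 C0 cnt]]]] := chain_count_above i0k (leqnn k).
  exists al, be, C; split=> // E Ec.
  by apply: le_trans (cnt E Ec (tail_group _ k) _) => //; rewrite ler_nat m_k_le_chain_count.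
(* When the modified index is the last one, no step crosses it, and the chain ends at a tail
   isomorphic to [E]. *)
have {}ki0 : i0 = k :> nat by apply/eqP; rewrite eqn_leq ki0 -ltnS ltn_ord.
have [al [be [C [al01 be0 C0 cnt]]]] := chain_count_below (leqnn i0).
exists al, be, C; split=> // E Ec.
have cT : #|tail_group (update G i0 E) k| = #|E|.
  rewrite [LHS]card_tail (bigD1 i0) //= ki0 ltnn update_eq big1 ?muln1 // => j ji.
  have jk : (j < k)%N.
    by move: ji; rewrite -val_eqE /= ki0 => ji; have := ltn_ord j; lia.
  by rewrite jk.
have := cnt E Ec (tail_group _ k); rewrite cT ki0 => /(_ (subxx _)).
by apply: le_trans; rewrite ler_nat m_k_le_chain_count.
Qed.

End GrowthUpdate.

End Growth.

(** * Reduction modulo [a] *)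

Lemma additive_exists (A B : zmodType) (f : A -> B) :
  {morph f : x y / x + y} -> exists g : {additive A -> B}, g =1 f.
Proof.
move=> fD; have fB : zmod_morphism f by exact: morphaddB.
pose m := GRing.isZmodMorphism.Build A B f fB.
pose f' : {additive A -> B} := HB.pack f m.
by exists f'.
Qed.

Lemma zmod_iso_of (A B : zmodType) (f : A -> B) :
  {morph f : x y / x + y} -> bijective f -> zmod_iso A B.
Proof.
move=> fD fbij; have [g gf] := additive_exists fD; exists g.
by apply: eq_bij fbij _ _; move=> x; rewrite gf.
Qed.

Lemma zmod_iso_refl (A : zmodType) : zmod_iso A A.
Proof. by apply: (@zmod_iso_of A A id) => //; exists id. Qed.

Lemma zmod_iso_sym (A B : zmodType) : zmod_iso A B -> zmod_iso B A.
Proof.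
move=> [f [g fK gK]]; apply: (@zmod_iso_of _ _ g); last by exists f.
by move=> x y; apply: (can_inj fK); rewrite raddfD !gK.
Qed.

Lemma zmod_iso_trans (A B C : zmodType) : zmod_iso A B -> zmod_iso B C -> zmod_iso A C.
Proof.
move=> [f fbij] [g gbij]; apply: (@zmod_iso_of _ _ (g \o f)); last exact: bij_comp.
by move=> x y /=; rewrite !raddfD.
Qed.

Lemma exponent_dvdP a (G : finZmodType) :
  reflect (forall x : G, x *+ a = 0) (exponent_dvd a G).
Proof.
apply: (iffP exponentP) => [e x|e x _]; first by rewrite -FinRing.zmodXgE e // inE.
by rewrite FinRing.zmodXgE e.
Qed.

Section TensorZmod.
Variables (X : zmodType) (a : nat).
Hypothesis a0 : (0 < a)%N.

Let one : Zmod a := inZp 1.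

Definition tunit (x : X) : tensor X (Zmod a) := tmul x one.

Lemma tunitD : {morph tunit : x y / x + y}.
Proof. by move=> x y; exact: tmulDl. Qed.

Lemma val_Zmod_one n : nat_of_ord (one *+ n) = (n %% a)%N.
Proof.
have modE m : (m %% a.-1.+1 = m %% a)%N by rewrite prednK.
elim: n => [|n IH]; first by rewrite mulr0n mod0n.
rewrite mulrSr; have -> : nat_of_ord (one *+ n + one) = ((n %% a + 1 %% a) %% a)%N.
  by rewrite -IH /= !modE.
by rewrite modnDm addn1.
Qed.

Lemma Zmod_oneX (b : Zmod a) : b = one *+ nat_of_ord b.
Proof.
apply: ord_inj; rewrite val_Zmod_one modn_small //.
by rewrite -[X in (_ < X)%N](prednK a0).
Qed.

Lemma tmulMn (x : X) (b : Zmod a) n : tmul x (b *+ n) = tmul x b *+ n.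
Proof.
elim: n => [|n IH]; last by rewrite !mulrS tmulDr IH.
by apply: (addrI (tmul x b)); rewrite -tmulDr mulr0n addr0 mulr0n addr0.
Qed.

Lemma tmulE x (b : Zmod a) : tmul x b = tunit (x *+ nat_of_ord b).
Proof. by rewrite {1}(Zmod_oneX b) tmulMn (morphaddMn tunitD). Qed.

Lemma tunit_surj (q : tensor X (Zmod a)) : exists x, tunit x = q.
Proof.
pose p : {additive freeAB X (Zmod a) -> tensor X (Zmod a)} :=
  \pi_(Quotient.quot (@tensor_null X (Zmod a)))%qT.
have [u uE] := additive_exists tunitD.
have <- : p (repr (q : Quotient.quot (@tensor_null X (Zmod a)))) = q.
  exact: (@reprK _ (Quotient.quot (@tensor_null X (Zmod a)))).
set D := repr _; rewrite -[D]freeg_sumE raddf_sum.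
exists (\sum_(z <- dom D) (z.1 *+ nat_of_ord z.2) *~ coeff z D).
rewrite -uE raddf_sum; apply: eq_bigr => -[x b] _.
rewrite -[coeff _ _]intz -freegU_mulz !raddfMz; congr (_ *~ _).
by rewrite uE -tmulE.
Qed.

(** Together with the surjectivity of [tunit] and [tensor_Zmod_exponent], this identifies the tensor
    product with the largest quotient of [X] killed by [a]. *)
Lemma tunit_factor (G : zmodType) (f : X -> G) : (forall g : G, g *+ a = 0) ->
  {morph f : x y / x + y} ->
  exists g : {additive tensor X (Zmod a) -> G}, forall x, g (tunit x) = f x.
Proof.
move=> aG fD.
have modG (g : G) n : g *+ (n %% a.-1.+1) = g *+ n.
  by rewrite prednK // {2}(divn_eq n a) mulrnDr mulnC mulrnA aG mul0rn add0r.
have [||g [gE _]] := @tensor_universal X (Zmod a) G (fun x b => f x *+ nat_of_ord b).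
- by move=> x y b; rewrite fD mulrnDl.
- by move=> x b b'; rewrite /= modG mulrnDr.
by exists g => x; rewrite gE /= modG.
Qed.

Lemma tensor_Zmod_exponent (q : tensor X (Zmod a)) : q *+ a = 0.
Proof.
have [x <-] := tunit_surj q; rewrite /tunit -tmulMn.
have -> : one *+ a = 0 by apply: ord_inj; rewrite val_Zmod_one modnn.
by apply: (addrI (tmul x 0)); rewrite -tmulDr !addr0.
Qed.

End TensorZmod.

Lemma zmod_iso_tensor (X Y Z : zmodType) : zmod_iso X Y -> zmod_iso (tensor X Z) (tensor Y Z).
Proof.
have lift (A B : zmodType) (f : {additive A -> B}) :
    exists g : {additive tensor A Z -> tensor B Z}, forall x z, g (tmul x z) = tmul (f x) z.
  have [||g [gE _]] := @tensor_universal A Z (tensor B Z) (fun x z => tmul (f x) z).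
  - by move=> x x' z; rewrite raddfD tmulDl.
  - by move=> x z z'; rewrite tmulDr.
  by exists g.
have idP (A : zmodType) (g : {additive tensor A Z -> tensor A Z}) :
    (forall x z, g (tmul x z) = tmul x z) -> g =1 id.
  move=> gE; have [h [_ hU]] := tensor_universal (@tmulDl A Z) (@tmulDr A Z).
  by move=> q; rewrite hU // -(hU idfun).
move=> [f [f' fK f'K]].
have [F' F'E] : exists g : {additive Y -> X}, g =1 f'.
  by apply: additive_exists => x y; apply: (can_inj fK); rewrite raddfD !f'K.
have [g gE] := lift _ _ f; have [g' g'E] := lift _ _ F'.
exists g; exists g' => q.
  by apply: (idP _ (g' \o g)) => x z /=; rewrite gE g'E F'E fK.
by apply: (idP _ (g \o g')) => x z /=; rewrite g'E gE F'E f'K.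
Qed.

Lemma zmod_iso_finite (A : zmodType) (I : finType) (F : I -> A) :
  (forall x, exists i, F i = x) -> exists B : finZmodType, zmod_iso A B.
Proof.
move=> Fsurj; pose e := undup [seq F i | i <- enum I].
have eP x : x \in e.
  by have [i <-] := Fsurj x; rewrite mem_undup map_f // mem_enum.
have fK : cancel (fun x => index x e) (fun n => nth 0 e n).
  by move=> x; rewrite nth_index.
have ax : Finite.axiom e by move=> x; rewrite count_uniq_mem ?undup_uniq // eP.
pose c := CanIsCountable fK.
pose cT : countType := HB.pack A c.
pose m := isFinite.Build A ax.
pose B : finZmodType := HB.pack A c m.
by exists B; apply: (@zmod_iso_of A B id) => //; exists id.
Qed.

(** The images of the generators of [X] generate the tensor product, and their coefficients matter
    only modulo [a], so it is finite. *)
Lemma tensor_class (a : nat) (X : zmodType) : (0 < a)%N -> fin_gen X ->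
  exists c : AbClass a, zmod_iso (tensor X (Zmod a)) (AbClass_rep c).
Proof.
move=> a0 [r [g gX]].
have tD := @tunitD X a.
pose F (c : {ffun 'I_r -> 'I_a}) : tensor X (Zmod a) := \sum_i tunit a (g i) *+ c i.
have [|B BX] := @zmod_iso_finite _ _ F.
  move=> q; have [x <-] := tunit_surj a0 q; have [c ->] := gX x.
  have lt i : (`|(c i %% a)%Z| < a)%N.
    by rewrite -ltz_nat gez0_abs ?ltz_pmod ?modz_ge0 // -?lt0n // -eqz_nat gt_eqF.
  exists [ffun i => Ordinal (lt i)]; have [u uE] := additive_exists tD.
  rewrite -uE raddf_sum; apply: eq_bigr => i _; rewrite ffunE raddfMz uE /=.
  rewrite pmulrn gez0_abs; last by rewrite modz_ge0 // gt_eqF.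
  rewrite /modz mulrzDr mulrNz (mulrC _ (Posz a)) mulrzA -pmulrn.
  by rewrite tensor_Zmod_exponent // mul0rz oppr0 addr0.
have [f [f' fK f'K]] := BX.
have Ba : exponent_dvd a B.
  by apply/exponent_dvdP => x; rewrite -(f'K x) -raddfMn tensor_Zmod_exponent // raddf0.
have [c [cP _]] := AbClass_repP Ba; exists c; exact: zmod_iso_trans BX cP.
Qed.

Lemma nSur_eq (a : nat) (X : zmodType) (B G : finZmodType) : (0 < a)%N ->
  exponent_dvd a G -> zmod_iso (tensor X (Zmod a)) B -> nSur X G = #|surjs B G|.
Proof.
move=> a0 /exponent_dvdP aG [f [f' fK f'K]].
have tD := @tunitD X a.
pose F (h : {ffun B -> G}) : X -> G := fun x => h (f (tunit a x)).
have piS b : exists x, f (tunit a x) = b.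
  by have [x xE] := tunit_surj a0 (f' b); exists x; rewrite xE f'K.
have FI : injective F.
  move=> h h' e; apply/ffunP => b; have [x <-] := piS b.
  by have := congr1 (fun u : X -> G => u x) e.
rewrite /nSur; have -> : Sur X G = (F @` [set` [fset h in surjs B G]%fset])%classic.
  apply/seteqP; split=> [u [uB uS]|u [h /= + <-]].
    have uD : {morph u : x y / x + y}.
      have u0 : u 0 = 0 by rewrite -(subrr 0) uB subrr.
      have uN y : u (- y) = - u y by rewrite -(sub0r y) uB u0 sub0r.
      by move=> x y; rewrite -{1}(opprK y) uB uN opprK.
    have [g gE] := tunit_factor a0 aG uD.
    exists [ffun b => g (f' b)]; last by apply/funext => x; rewrite /F ffunE fK gE.
    suff hS : [ffun b => g (f' b)] \in surjs B G by rewrite /= in_fset.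
    apply/surjsP; split=> [x y|y].
      rewrite !ffunE -raddfD; congr (g _).
      by apply: (can_inj fK); rewrite raddfD !f'K.
    by have [x <-] := uS y; exists (f (tunit a x)); rewrite ffunE fK gE.
  rewrite in_fset => /surjsP[hD hS]; split.
    by move=> x y; rewrite /F (morphaddB tD) raddfB (morphaddB hD).
  by move=> y; have [b <-] := hS y; have [x <-] := piS b; exists x.
rewrite fset_set_image // set_fsetK card_imfset //=.
by rewrite card_finset.
Qed.

(** * The sieve *)

(* [#|B| %/ #|G|] is the order of the kernel of every surjection of [B] onto [G]. *)
Definition index_coprime (Q : seq nat) (B G : finZmodType) : bool :=
  all (fun p => ~~ (p %| #|B| %/ #|G|)%N) Q.

Definition nsurjQ (Q : seq nat) (B G : finZmodType) : nat :=
  if index_coprime Q B G then #|surjs B G| else 0%N.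

Lemma card_finZmod_gt0 (A : finZmodType) : (0 < #|A|)%N.
Proof. by apply/card_gt0P; exists 0. Qed.

Lemma nsurjQ_le (Q : seq nat) (B G : finZmodType) : (nsurjQ Q B G <= nsurjQ [::] B G)%N.
Proof. by rewrite /nsurjQ /=; case: ifP. Qed.

(** Passing from [A] to an extension by [elem p r] divides the order of the kernel by a power of
    [p], which the primes of [Q] do not see since [p] is not among them. Sieving at [p] is thus
    compatible with the conditions already imposed. *)
Lemma nsurjQ_ext (Q : seq nat) (p r : nat) (B A : finZmodType) (c : cocycle A (elem p r)) :
  prime p -> all prime Q -> p \notin Q ->
  nsurjQ Q B (ext c) = (index_coprime Q B A * #|surjs B (ext c)|)%N.
Proof.
move=> p_pr Q_pr pQ; rewrite /nsurjQ.
have [->|/set0Pn[f fS]] := eqVneq (surjs B (ext c)) set0;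
  first by rewrite cards0 muln0 if_same.
suff -> : index_coprime Q B (ext c) = index_coprime Q B A by case: ifP => _; rewrite ?mul1n.
have cB := card_kert fS; rewrite card_ext card_elem // in cB.
apply: eq_in_all => q qQ; congr (~~ _).
rewrite cB -mulnA mulKn ?card_finZmod_gt0 // mulnA card_ext card_elem //.
rewrite mulKn ?muln_gt0 ?card_finZmod_gt0 ?expn_gt0 ?prime_gt0 //.
have q_pr := allP Q_pr q qQ.
have qp : (q %| p)%N = false.
  by rewrite dvdn_prime2 //; apply/negbTE; apply: contraNneq pQ => <-.
by rewrite Euclid_dvdM // Euclid_dvdX // qp.
Qed.

Lemma surjs_exponent (a : nat) (B G : finZmodType) (f : {ffun B -> G}) :
  exponent_dvd a B -> f \in surjs B G -> exponent_dvd a G.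
Proof.
move=> /exponent_dvdP aB /surjsP[fD fS]; apply/exponent_dvdP => y.
by have [x <-] := fS y; rewrite -(morphaddMn fD) aB (morphadd0 fD).
Qed.

Section Step.
Variables (R : realFieldType) (a p : nat).
Hypothesis p_pr : prime p.

(** The power [(p ^ r) ^ #|A|] undoes the multiplicity [#V ^ #A] produced by summing over all
    cocycles. *)
Definition step_coef (A : finZmodType) (r : nat) : R :=
  bonf_coef R p r / ((p ^ r) ^ #|A|)%N%:R.

Lemma step_coef_ge0 A r : 0 <= step_coef A r.
Proof.
rewrite /step_coef /bonf_coef mulr_ge0 ?invr_ge0 //.
by apply: prodr_ge0 => j _; rewrite subr_ge0 exprn_ege1 // ler1n prime_gt0.
Qed.

Lemma nsurjQ_bonferroni (Q : seq nat) (B A : finZmodType) (N : nat) :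
  exponent_dvd a B -> all prime Q -> p \notin Q ->
  `|(nsurjQ (p :: Q) B A)%:R - \sum_(r < N.+1) (-1) ^+ r * (step_coef A r *
      \sum_(c : cocycle A (elem p r) | exponent_dvd a (ext c)) (nsurjQ Q B (ext c))%:R)|
  <= step_coef A N.+1 *
      \sum_(c : cocycle A (elem p N.+1) | exponent_dvd a (ext c)) (nsurjQ Q B (ext c))%:R.
Proof.
move=> aB Q_pr pQ; have p0 := prime_gt0 p_pr.
pose q : R := (index_coprime Q B A)%:R.
have tE r : step_coef A r *
      \sum_(c : cocycle A (elem p r) | exponent_dvd a (ext c)) (nsurjQ Q B (ext c))%:R =
    q * \sum_(f in surjs B A) bonf_coef R p r * #|surjs (kert f) (elem p r)|%:R.
  rewrite -big_distrr /= -!natr_sum.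
  have -> : (\sum_(c : cocycle A (elem p r) | exponent_dvd a (ext c)) nsurjQ Q B (ext c) =
     index_coprime Q B A * ((p ^ r) ^ #|A| * \sum_(f in surjs B A) #|surjs (kert f) (elem p r)|))%N.
    rewrite -[in RHS](card_elem r p_pr) -sum_card_surjs_ext big_distrr /= big_mkcond /=.
    (* An extension whose exponent does not divide [a] receives no surjection from [B], so only
       moments covered by the hypotheses appear. *)
    apply: eq_bigr => c _; rewrite -nsurjQ_ext //; case: ifP => // /negP naE.
    apply/esym; rewrite nsurjQ_ext // (_ : surjs B (ext c) = set0) ?cards0 ?muln0 //.
    by apply/setP => f; rewrite in_set0; apply/negP => /(surjs_exponent aB).
  rewrite /step_coef !natrM -/q mulrCA [_ / _ * _]mulrA -(mulrA (bonf_coef R p r)) mulVf ?mulr1 //.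
  by rewrite pnatr_eq0 -lt0n !expn_gt0 p0.
have uE : (nsurjQ (p :: Q) B A)%:R =
    q * \sum_(f in surjs B A) (~~ (p %| #|{: kert f}|)%N)%:R :> R.
  rewrite /nsurjQ /index_coprime /= -/(index_coprime Q B A) /q.
  have eK f : f \in surjs B A -> #|{: kert f}| = (#|B| %/ #|A|)%N.
    by move=> fS; rewrite (card_kert fS) mulKn // card_finZmod_gt0.
  rewrite (eq_bigr (fun=> (~~ (p %| #|B| %/ #|A|)%N)%:R)) => [|f fS]; last by rewrite eK.
  rewrite sumr_const -mulrnA -natrM; congr _%:R.
  by case: (index_coprime _ _ _); case: (~~ _) => //=; rewrite ?mul1n ?mul0n.
rewrite [\sum_(r < N.+1) _](_ : _ = q * \sum_(f in surjs B A) \sum_(r < N.+1)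
    (-1) ^+ r * (bonf_coef R p r * #|surjs (kert f) (elem p r)|%:R)); last first.
  rewrite exchange_big mulr_sumr /=; apply: eq_bigr => r _; rewrite tE mulrCA.
  by congr (_ * _); rewrite mulr_sumr.
rewrite uE tE -mulrBr normrM [ `|q|]ger0_norm ?ler0n // ler_wpM2l ?ler0n //.
rewrite -sumrB; apply: le_trans (ler_norm_sum _ _ _) _.
by apply: ler_sum => f _; apply: bonferroni_surjs.
Qed.

End Step.

Lemma iso_card_surjs (B B' G : finZmodType) : zmod_iso B B' -> #|surjs B G| = #|surjs B' G|.
Proof.
suff le (C C' : finZmodType) : zmod_iso C C' -> (#|surjs C' G| <= #|surjs C G|)%N.
  by move=> BB'; apply/eqP; rewrite eqn_leq !le //; exact: zmod_iso_sym.
move=> [f [g fK gK]].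
pose F (u : {ffun C' -> G}) : {ffun C -> G} := [ffun x => u (f x)].
have FI : injective F.
  move=> u v /ffunP e; apply/ffunP => y.
  by have := e (g y); rewrite !ffunE gK.
rewrite -(card_imset _ FI); apply/subset_leq_card/subsetP => _ /imsetP[u /surjsP[uD uS] ->].
apply/surjsP; split=> [x y|y]; first by rewrite !ffunE raddfD uD.
by have [x <-] := uS y; exists (g x); rewrite ffunE gK.
Qed.

Lemma card_surjs_self_gt0 (G : finZmodType) : (0 < #|surjs G G|)%N.
Proof.
apply/card_gt0P; exists [ffun x => x]; apply/surjsP.
by split=> [x y|y]; [rewrite !ffunE|exists y; rewrite ffunE].
Qed.

(** The kernel is killed by [a], so a prime dividing its order divides [a] and belongs to [Q]: a
    surjection survives the sieve only if its kernel is trivial. *)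
Lemma nsurjQ_full (a : nat) (Q : seq nat) (B G : finZmodType) :
  (0 < a)%N -> exponent_dvd a B -> all prime Q -> {subset primes a <= Q} ->
  nsurjQ Q B G = (`[< zmod_iso B G >] * #|surjs G G|)%N.
Proof.
move=> a0 /exponent_dvdP aB Q_pr Qa; rewrite /nsurjQ.
have [iso|niso] := asboolP (zmod_iso B G).
  rewrite mul1n (iso_card_surjs _ iso) ifT // /index_coprime.
  have -> : (#|B| %/ #|G| = 1)%N.
    have [f fbij] := iso; rewrite (bij_eq_card fbij) divnn; by rewrite card_finZmod_gt0.
  by apply/allP => q /(allP Q_pr)/prime_gt1 q1; rewrite dvdn1 gtn_eqF.
rewrite mul0n; case: ifP => // /allP cop; apply/eqP; rewrite cards_eq0;
  apply/set0Pn => -[f fS].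
apply: niso; have cB := card_kert fS; have [fD fsurj] := surjsP _ fS.
have k1 : (#|{: kert f}| = 1)%N.
  apply/eqP; rewrite eqn_leq card_finZmod_gt0 andbT leqNgt; apply/negP => k1.
  have q_pr := pdiv_prime k1; set q := pdiv _ in q_pr.
  have qB : (q %| #|B|)%N by rewrite cB dvdn_mull // pdiv_dvd.
  have qQ : q \in Q.
    apply: Qa; rewrite mem_primes q_pr a0 /=.
    have [|z _ oz] := @Cauchy _ q [set: B]%G q_pr; first by rewrite cardsT.
    by rewrite -oz order_dvdn FinRing.zmodXgE aB.
  by have := cop q qQ; rewrite cB mulKn ?card_finZmod_gt0 // pdiv_dvd.
apply: (zmod_iso_of fD).
have fI : injective f.
  apply/injectiveP; rewrite /dinjectiveb; apply/injectiveP => x y e.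
  have xyK : x - y \in kpred f by rewrite mem_kpred ?(morphaddB fD) ?e ?subrr //; apply/homsP.
  have z0 : Sub (x - y) xyK = 0 :> kert f.
    by apply: (fintype_le1P _); rewrite k1.
  by apply/eqP; rewrite -subr_eq0; apply/eqP; have := congr1 val z0.
apply: inj_card_bij fI _; by rewrite cB k1 muln1.
Qed.

Local Open Scope classical_set_scope.

(** * Positive functionals and passage to the limit *)

Section PositiveFunctional.
Variables (R : realType) (J : Type).
Implicit Types (phi psi : J -> R).

(** These are the properties of expectation on which the limits rest. Values lie in [\bar R] because
    an expectation may be infinite for small [n]; restricting to nonnegative functions avoids
    carrying integrability along. *)
Record pos_functional (E : (J -> R) -> \bar R) : Prop := PosFunctional {
  pos_functional_ge0 : forall phi, (forall j, 0 <= phi j) -> (0 <= E phi)%E;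
  pos_functionalD : forall phi psi, (forall j, 0 <= phi j) -> (forall j, 0 <= psi j) ->
    E (fun j => phi j + psi j) = (E phi + E psi)%E;
  pos_functionalZ : forall c phi, 0 <= c -> (forall j, 0 <= phi j) ->
    E (fun j => c * phi j) = (c%:E * E phi)%E }.

Variable E : (J -> R) -> \bar R.
Hypothesis Epos : pos_functional E.

Lemma pos_functional_le phi psi : (forall j, 0 <= phi j <= psi j) -> (E phi <= E psi)%E.
Proof.
move=> le; have phi0 j : 0 <= phi j by case/andP: (le j).
have d0 j : 0 <= psi j - phi j by rewrite subr_ge0; case/andP: (le j).
rewrite (_ : psi = fun j => phi j + (psi j - phi j)); last first.
  by apply/funext => j; rewrite addrC subrK.
by rewrite pos_functionalD // leeDl // pos_functional_ge0.
Qed.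

Lemma pos_functional_sum (I : Type) (s : seq I) (P : pred I) (F : I -> J -> R) :
  (forall i j, 0 <= F i j) ->
  E (fun j => \sum_(i <- s | P i) F i j) = (\sum_(i <- s | P i) E (F i))%E.
Proof.
move=> F0; elim: s => [|i s IH].
  rewrite big_nil (_ : (fun j => _) = fun j => 0 * 0).
    by rewrite pos_functionalZ // mul0e.
  by apply/funext => j; rewrite big_nil mul0r.
rewrite big_cons; case: ifP => Pi.
  rewrite -IH -pos_functionalD //; last by move=> j; rewrite sumr_ge0.
  by congr E; apply/funext => j; rewrite big_cons Pi.
by rewrite -IH; congr E; apply/funext => j; rewrite big_cons Pi.
Qed.

(** To avoid subtraction, even and odd terms are collected in [P] and [Q], and the hypothesis
    becomes [u + Q <= P + t N.+1] and [P <= u + Q + t N.+1]. The first inequality also makes [E u]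
    finite. *)
Lemma pos_functional_bonferroni (u : J -> R) (t : nat -> J -> R) (N : nat) :
  (forall j, 0 <= u j) -> (forall r j, 0 <= t r j) ->
  (forall j, `|u j - \sum_(r < N.+1) (-1) ^+ r * t r j| <= t N.+1 j) ->
  (forall r, (r <= N.+1)%N -> E (t r) \is a fin_num) ->
  E u \is a fin_num /\
  `|fine (E u) - \sum_(r < N.+1) (-1) ^+ r * fine (E (t r))| <= fine (E (t N.+1)).
Proof.
move=> u0 t0 ut tfin.
pose P j := \sum_(r < N.+1 | ~~ odd r) t r j; pose Q j := \sum_(r < N.+1 | odd r) t r j.
have PQ j : \sum_(r < N.+1) (-1) ^+ r * t r j = P j - Q j.
  rewrite (bigID (fun r : 'I_N.+1 => odd r)) /= addrC; congr (_ + _).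
    by apply: eq_bigr => r /negbTE ro; rewrite -signr_odd ro mul1r.
  by rewrite -sumrN; apply: eq_bigr => r ro; rewrite -signr_odd ro expr1 mulN1r.
have P0 j : 0 <= P j by rewrite sumr_ge0.
have Q0 j : 0 <= Q j by rewrite sumr_ge0.
have tf (r : 'I_N.+1) : E (t r) \is a fin_num by apply: tfin; rewrite ltnW.
have EP : E P = (\sum_(r < N.+1 | ~~ odd r) fine (E (t r)))%:E.
  rewrite pos_functional_sum // -sumEFin; apply: eq_bigr => r _; by rewrite fineK.
have EQ : E Q = (\sum_(r < N.+1 | odd r) fine (E (t r)))%:E.
  rewrite pos_functional_sum // -sumEFin; apply: eq_bigr => r _; by rewrite fineK.
have tN : E (t N.+1) \is a fin_num by exact: tfin.
have le1 : (E u + E Q <= E P + E (t N.+1))%E.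
  rewrite -!pos_functionalD //; apply: pos_functional_le => j; rewrite addr_ge0 //=.
  by have := ut j; rewrite PQ ler_norml => /andP[_]; lra.
have le2 : (E P <= E u + E Q + E (t N.+1))%E.
  rewrite -!pos_functionalD // => [|j]; last by rewrite addr_ge0.
  apply: pos_functional_le => j; rewrite P0 /=.
  by have := ut j; rewrite PQ ler_norml => /andP[+ _]; lra.
have ufin : E u \is a fin_num.
  rewrite ge0_fin_numE ?pos_functional_ge0 //; apply: le_lt_trans (_ : E P + E (t N.+1) < _)%E.
    by apply: le_trans le1; rewrite leeDl // pos_functional_ge0.
  by rewrite EP -(fineK tN) -EFinD ltry.
split=> //.
have -> : \sum_(r < N.+1) (-1) ^+ r * fine (E (t r)) =
    (\sum_(r < N.+1 | ~~ odd r) fine (E (t r))) - (\sum_(r < N.+1 | odd r) fine (E (t r))).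
  rewrite (bigID (fun r : 'I_N.+1 => odd r)) /= addrC; congr (_ + _).
    by apply: eq_bigr => r /negbTE ro; rewrite -signr_odd ro mul1r.
  by rewrite -sumrN; apply: eq_bigr => r ro; rewrite -signr_odd ro expr1 mulN1r.
move: le1 le2; rewrite EP EQ -(fineK ufin) -(fineK tN) -!EFinD !lee_fin /=.
by move=> le1 le2; rewrite ler_norml; apply/andP; split; lra.
Qed.

End PositiveFunctional.

Lemma ler_cvgn (R : realType) (f g : nat -> R) (l l' : R) :
  f n @[n --> \oo] --> l -> g n @[n --> \oo] --> l' ->
  (\forall n \near \oo, f n <= g n) -> l <= l'.
Proof.
move=> fl gl' fg; rewrite -subr_ge0.
have gf : g n - f n @[n --> \oo] --> l' - l by apply: cvgB.
apply: (cvgr_to_ge gf); by apply: filterS fg => n; rewrite subr_ge0.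
Qed.

Section BonferroniLimit.
Variables (R : realType) (J : Type) (E : nat -> (J -> R) -> \bar R).
Hypothesis Epos : forall n, pos_functional (E n).

(** For large [n] the partial sums of orders [N] and [M] approximate the same [E n u], so their
    limits differ by at most [tau N.+1 + tau M.+1]; the series in [tau] is therefore Cauchy. Its
    value depends on [tau] alone, not on the functionals. *)
Lemma bonferroni_limit (u : J -> R) (t : nat -> J -> R) (tau : nat -> R) :
  (forall j, 0 <= u j) -> (forall r j, 0 <= t r j) ->
  (forall N j, `|u j - \sum_(r < N.+1) (-1) ^+ r * t r j| <= t N.+1 j) ->
  (forall r, E n (t r) @[n --> \oo] --> (tau r)%:E) ->
  tau r @[r --> \oo] --> 0 ->
  E n u @[n --> \oo] --> (limn (fun N => \sum_(r < N.+1) (-1) ^+ r * tau r))%:E.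
Proof.
move=> u0 t0 ut ttau tau0.
pose a r n := fine (E n (t r)).
have tfin r : \forall n \near \oo, E n (t r) \is a fin_num.
  by have /fine_cvgP[] := ttau r.
have acvg r : a r n @[n --> \oo] --> tau r by have /fine_cvgP[] := ttau r.
have tfinN N : \forall n \near \oo, forall r, (r <= N)%N -> E n (t r) \is a fin_num.
  elim: N => [|N IH]; first by near=> n => r; rewrite leqn0 => /eqP->; near: n.
  near=> n => r; rewrite leq_eqVlt => /orP[/eqP->|]; first by near: n.
  by rewrite ltnS; move: r; near: n.
have main N : \forall n \near \oo, E n u \is a fin_num /\
    `|fine (E n u) - \sum_(r < N.+1) (-1) ^+ r * a r n| <= a N.+1 n.
  near=> n; apply: (pos_functional_bonferroni (Epos n)) => //.
  by near: n; exact: tfinN.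
pose sg N := \sum_(r < N.+1) (-1) ^+ r * tau r.
have sacvg N : (\sum_(r < N.+1) (-1) ^+ r * a r n) @[n --> \oo] --> sg N.
  apply: cvg_big => [|r _]; [exact: add_continuous|exact: cvgMr].
have close N M : `|sg N - sg M| <= tau N.+1 + tau M.+1.
  have c1 : `|(\sum_(r < N.+1) (-1) ^+ r * a r n) - (\sum_(r < M.+1) (-1) ^+ r * a r n)| @[n --> \oo]
     --> `|sg N - sg M| by apply: cvg_norm; apply: cvgB.
  have c2 : a N.+1 n + a M.+1 n @[n --> \oo] --> tau N.+1 + tau M.+1 by apply: cvgD.
  apply: (ler_cvgn c1 c2); near=> n.
  have [_ mN] : E n u \is a fin_num /\
    `|fine (E n u) - \sum_(r < N.+1) (-1) ^+ r * a r n| <= a N.+1 n by near: n.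
  have [_ mM] : E n u \is a fin_num /\
    `|fine (E n u) - \sum_(r < M.+1) (-1) ^+ r * a r n| <= a M.+1 n by near: n.
  apply: le_trans (lerD mN mM); rewrite [X in _ <= X + _]distrC; exact: ler_distD.
have tausmall e : 0 < e -> exists N, forall M, (N <= M)%N -> `|tau M| < e.
  move=> e0; have /cvgrPdist_lt/(_ e e0)[N _ NP] := tau0; exists N => M NM.
  by have := NP M NM; rewrite sub0r normrN.
have sgcvg : cvgn sg.
  apply/cauchy_cvgP/cauchy_exP => e e0; have [|N NP] := tausmall (e / 2);
    first by rewrite divr_gt0.
  exists (sg N); exists N => // M /= NM; apply: le_lt_trans (close N M) _.
  have h1 := NP N.+1 (leqnSn _); have h2 := NP M.+1 (leqW NM).
  by move: h1 h2; rewrite !ltr_norml => /andP[_ h1] /andP[_ h2]; lra.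
set l := limn _; have sgl : sg N @[N --> \oo] --> l by exact: sgcvg.
have closel N : `|sg N - l| <= tau N.+1.
  have c1 : `|sg N - sg M| @[M --> \oo] --> `|sg N - l|.
    by apply: cvg_norm; apply: cvgB => //; exact: cvg_cst.
  have c2 : tau N.+1 + tau M.+1 @[M --> \oo] --> tau N.+1 + 0.
    by apply: cvgD; [exact: cvg_cst|rewrite (cvg_shiftS tau)].
  rewrite addr0 in c2; apply: (ler_cvgn c1 c2); near=> M; exact: close.
apply/fine_cvgP; split; first by near=> n; have [] : E n u \is a fin_num /\
    `|fine (E n u) - \sum_(r < 0.+1) (-1) ^+ r * a r n| <= a 0.+1 n by near: n.
(* One quarter is for [l - sg N], one for the convergence of the partial sum, and two for
   [a N.+1 n], which is within [e / 4] of a quantity below [e / 4]. *)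
apply/cvgrPdist_lt => e e0; have [|N NP] := tausmall (e / 4); first by rewrite divr_gt0.
have e4 : 0 < e / 4 by rewrite divr_gt0.
near=> n.
have [_ m1] : E n u \is a fin_num /\
    `|fine (E n u) - \sum_(r < N.+1) (-1) ^+ r * a r n| <= a N.+1 n by near: n.
have m2 : `|sg N - \sum_(r < N.+1) (-1) ^+ r * a r n| < e / 4.
  by near: n; have /cvgrPdist_lt := sacvg N; apply.
have m3 : `|tau N.+1 - a N.+1 n| < e / 4.
  by near: n; have /cvgrPdist_lt := acvg N.+1; apply.
have m4 := closel N; have m5 := NP N.+1 (leqnSn _).
move: m1 m2 m3 m4 m5; rewrite /= !ltr_norml !ler_norml.
move=> /andP[? ?] /andP[? ?] /andP[? ?] /andP[? ?] /andP[? ?].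
by apply/andP; split; lra.
Unshelve. all: by end_near.
Qed.

End BonferroniLimit.

(** * Decay of the sieve terms *)

Section Decay.
Variables (R : realType) (p : nat).
Hypothesis p_pr : prime p.

Lemma rpow_decay (al be C s d : R) (x : nat -> R) : al < 1 / 2 -> 0 <= C ->
  (forall r, 0 <= x r <= rpow p (- (r%:R * (r%:R - 1) / 2)) *
     (rpow p (d * r%:R) * (C * rpow p (al * (s + r%:R) ^+ 2 + be * (s + r%:R))))) ->
  x r @[r --> \oo] --> 0.
Proof.
move=> al1 C0 xle; have p1 := prime_gt1 p_pr.
pose e := 1 / 2 - al; have e0 : 0 < e by rewrite /e subr_gt0.
(* The exponent of the bound, increased by [r], is [- e r ^ 2 + B r + al s ^ 2 + be s]; the [3 / 2]
   is [1 / 2] from [r (r - 1) / 2] plus [1] from the added [r]. Its maximum is [K], which leaves a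
   geometric sequence of ratio [1 / p]. *)
pose B := d + 2 * al * s + be + 3 / 2.
pose K := B ^+ 2 / (4 * e) + al * s ^+ 2 + be * s.
have bound r : x r <= C * rpow p K * (p%:R^-1) ^+ r.
  have /andP[_] := xle r; move/le_trans; apply.
  rewrite [X in _ * X <= _]mulrCA [leLHS]mulrCA -[leRHS]mulrA ler_wpM2l //.
  rewrite -!rpowD.
  have -> : (p%:R^-1) ^+ r = rpow p (- r%:R) :> R.
    by rewrite exprVn -natrX -rpow_nat // /rpow mulNr expRN.
  rewrite -rpowD; apply: ler_rpow => //; rewrite /K /B /e.
  pose w := r%:R - (d + 2 * al * s + be + 3 / 2) / (2 * (1 / 2 - al)).
  have w0 : 0 <= (1 / 2 - al) * w ^+ 2 by rewrite mulr_ge0 ?sqr_ge0 // ltW.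
  rewrite -subr_ge0; apply: le_trans w0 _; rewrite le_eqVlt; apply/orP; left; apply/eqP.
  by rewrite /w; field; rewrite gt_eqF //; lra.
apply: (@squeeze_cvgr _ _ _ _ (fun=> 0) (fun r => C * rpow p K * (p%:R^-1) ^+ r)).
- by apply: nearW => r; have /andP[-> _] := xle r; exact: bound.
- exact: cvg_cst.
rewrite -[X in _ --> X](mulr0 (C * rpow p K)); apply: cvgMr; apply: cvg_expr.
rewrite ger0_norm ?invr_ge0 // invf_lt1 ?ltr1n // ltr0n; exact: prime_gt0.
Qed.

Lemma bonf_coef_le r : bonf_coef R p r <= rpow p (- (r%:R * (r%:R - 1) / 2)).
Proof.
have p0 := prime_gt0 p_pr.
rewrite /bonf_coef (_ : rpow p _ = (rpow p (r%:R * (r%:R - 1) / 2))^-1);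
  last by rewrite /rpow mulNr expRN.
have key : rpow p (r%:R * (r%:R - 1) / 2 : R) <= \prod_(j < r) (p%:R ^+ j.+1 - 1).
  elim: r => [|r IH]; first by rewrite big_ord0 !mul0r -[0](mulr0n 1) rpow_nat.
  rewrite big_ord_recr /=.
  have -> : r.+1%:R * (r.+1%:R - 1) / 2 = r%:R * (r%:R - 1) / 2 + r%:R :> R.
    by rewrite -natr1; field.
  rewrite rpowD ler_pM ?rpow_ge0 // rpow_nat // natrX.
  rewrite exprS lerBrDr.
  have p2 : 2 <= p%:R :> R by rewrite ler_nat prime_gt1.
  have q1 : 1 <= p%:R ^+ r :> R by rewrite exprn_ege1 // ler1n.
  nra.
by rewrite lef_pV2 // posrE; [apply: lt_le_trans key|]; exact: rpow_gt0.
Qed.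

End Decay.

Lemma ext_card_factors (p r : nat) (A : finZmodType) (c : cocycle A (elem p r)) : prime p ->
  ((#|{: ext c}|)`_p^' <= #|A|)%N /\ logn p #|{: ext c}| = (logn p #|A| + r)%N.
Proof.
move=> p_pr; have A0 := card_finZmod_gt0 A.
have pr0 : (0 < p ^ r)%N by rewrite expn_gt0 prime_gt0.
rewrite card_ext card_elem //; split.
  have part1 : ((p ^ r)`_p^' = 1)%N by apply: part_p'nat; rewrite pnatNK pnatX pnat_id.
  by rewrite partnM // part1 muln1; exact: dvdn_leq (dvdn_part _ _).
by rewrite lognM // pfactorK.
Qed.

Lemma card_cocycle (p r : nat) (A : finZmodType) : prime p ->
  (#|{: cocycle A (elem p r)}| <= p ^ (#|A| * #|A| * r))%N.
Proof.
move=> p_pr; apply: leq_trans (_ : #|{ffun A * A -> elem p r}| <= _)%N.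
  by rewrite card_sub; exact: max_card.
by rewrite card_ffun card_prod card_elem // -expnM mulnC.
Qed.

(** * Convergence of the sieved moments *)

Section Limits.
Variables (R : realType) (k a : nat).
Notation J := {ffun 'I_k.+1 -> AbClass a}.
Notation groups := ('I_k.+1 -> finZmodType).

Definition sur_weight (Q : 'I_k.+1 -> seq nat) (G : groups) (h : J) : R :=
  \prod_i (nsurjQ (Q i) (AbClass_rep (h i)) (G i))%:R.

Lemma sur_weight_ge0 Q G h : 0 <= sur_weight Q G h.
Proof. by apply: prodr_ge0 => i _. Qed.

Lemma sur_weight_le Q G h : 0 <= sur_weight Q G h <= sur_weight (fun=> [::]) G h.
Proof.
rewrite sur_weight_ge0 /=; apply: ler_prod => i _.
by rewrite ler0n ler_nat nsurjQ_le.
Qed.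

Definition sieve (s : seq ('I_k.+1 * nat)) (i : 'I_k.+1) : seq nat :=
  [seq x.2 | x <- s & x.1 == i].

Variable E : bool -> nat -> (J -> R) -> \bar R.
Hypothesis Epos : forall b n, pos_functional (E b n).
Hypothesis moments : forall b (G : groups), (forall i, exponent_dvd a (G i)) ->
  E b n (sur_weight (fun=> [::]) G) @[n --> \oo] --> (m_k G)%:R%:E.

(** Sieving only decreases the weight, so the growth estimate for [m_k] applies to the limits at
    every stage of the sieve. *)
Lemma limit_bounds Q (G : groups) (l : R) : (forall i, exponent_dvd a (G i)) ->
  E true n (sur_weight Q G) @[n --> \oo] --> l%:E -> 0 <= l <= (m_k G)%:R.
Proof.
move=> Ga El; apply/andP; split.
  rewrite -lee_fin; apply: (cvge_to_ge El); apply: nearW => n.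
  exact/pos_functional_ge0/sur_weight_ge0.
rewrite -lee_fin; apply: (lee_cvg_to El (moments true Ga)); apply: nearW => n.
by apply: pos_functional_le => // h; exact: sur_weight_le.
Qed.

Lemma sur_weight_update Q (G : groups) (i0 : 'I_k.+1) (A : finZmodType) q h :
  sur_weight (fun i => if i == i0 then q else Q i) (update G i0 A) h =
  (nsurjQ q (AbClass_rep (h i0)) A)%:R *
  \prod_(i | i != i0) (nsurjQ (Q i) (AbClass_rep (h i)) (G i))%:R.
Proof.
rewrite /sur_weight (bigD1 i0) //= eqxx update_eq; congr (_ * _).
by apply: eq_bigr => i ii0; rewrite (negbTE ii0) /update (negbTE ii0).
Qed.

Lemma update_id (G : groups) i0 : update G i0 (G i0) = G.
Proof. by apply/funext => i; rewrite /update; case: eqP => // ->. Qed.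

(** The indices other than [i0] contribute a common nonnegative factor [W], by which the
    one-variable inequalities are multiplied. The limit is built from values [L] independent of [b],
    so the two sequences keep equal limits. *)
Lemma sur_weight_cvg_step (Q : 'I_k.+1 -> seq nat) (i0 : 'I_k.+1) (p : nat) :
  prime p -> all prime (Q i0) -> p \notin Q i0 ->
  (forall G : groups, (forall i, exponent_dvd a (G i)) ->
     exists l : R, forall b, E b n (sur_weight Q G) @[n --> \oo] --> l%:E) ->
  forall G : groups, (forall i, exponent_dvd a (G i)) ->
     exists l : R, forall b,
       E b n (sur_weight (fun i => if i == i0 then p :: Q i0 else Q i) G) @[n --> \oo] --> l%:E.
Proof.
move=> p_pr Q_pr pQ IH G Ga; set A := G i0.
have [L LP] : exists L : groups -> R, forall G : groups, (forall i, exponent_dvd a (G i)) ->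
    forall b, E b n (sur_weight Q G) @[n --> \oo] --> (L G)%:E.
  have ex (G' : groups) : exists l : R, (forall i, exponent_dvd a (G' i)) ->
      forall b, E b n (sur_weight Q G') @[n --> \oo] --> l%:E.
    have [G'a|nG'] := pselect (forall i, exponent_dvd a (G' i)); last by exists 0.
    by have [l lP] := IH G' G'a; exists l.
  by have [L LP] := choice ex; exists L.
have QE : Q = fun i => if i == i0 then Q i0 else Q i.
  by apply/funext => i; case: eqP => // ->.
have exp_update (B : finZmodType) : exponent_dvd a B -> forall i, exponent_dvd a (update G i0 B i).
  by move=> Ba i; rewrite /update; case: ifP.
pose W (h : J) : R := \prod_(i | i != i0) (nsurjQ (Q i) (AbClass_rep (h i)) (G i))%:R.
have W0 h : 0 <= W h by apply: prodr_ge0.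
pose t r (h : J) : R := step_coef R p A r *
  \sum_(c : cocycle A (elem p r) | exponent_dvd a (ext c)) sur_weight Q (update G i0 (ext c)) h.
have tE r h : t r h = step_coef R p A r *
  (\sum_(c : cocycle A (elem p r) | exponent_dvd a (ext c)) (nsurjQ (Q i0) (AbClass_rep (h i0)) (ext c))%:R) * W h.
  rewrite /t -mulrA; congr (_ * _); rewrite mulr_suml; apply: eq_bigr => c _.
  by rewrite {1}QE sur_weight_update.
pose tau r : R := step_coef R p A r *
  \sum_(c : cocycle A (elem p r) | exponent_dvd a (ext c)) L (update G i0 (ext c)).
have coef0 r := step_coef_ge0 R p_pr A r.
exists (limn (fun N => \sum_(r < N.+1) (-1) ^+ r * tau r)) => b.
apply: (@bonferroni_limit R J (E b) (Epos b) _ t tau).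
- by move=> h; exact: sur_weight_ge0.
- by move=> r h; rewrite mulr_ge0 // sumr_ge0 // => c _; exact: sur_weight_ge0.
- move=> N h; rewrite -{1}(update_id G i0) sur_weight_update -/(W h) tE.
  under eq_bigr do rewrite tE mulrA.
  rewrite -mulr_suml -mulrBl normrM [ `|W h|]ger0_norm // ler_wpM2r //.
  by apply: nsurjQ_bonferroni => //; exact: AbClass_rep_exponent.
- move=> r; rewrite /tau EFinM -sumEFin.
  rewrite (_ : (fun n => E b n (t r)) = fun n => ((step_coef R p A r)%:E *
     \sum_(c : cocycle A (elem p r) | exponent_dvd a (ext c)) E b n (sur_weight Q (update G i0 (ext c))))%E).
    apply: cvgeZl => //; apply: cvg_nnesum => c ca.
      by apply: nearW => n; exact/pos_functional_ge0/sur_weight_ge0.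
    by apply: LP; exact: exp_update.
  apply/funext => n; rewrite pos_functionalZ //; last first.
    by move=> h; rewrite sumr_ge0 // => c _; exact: sur_weight_ge0.
  by rewrite pos_functional_sum // => c h; exact: sur_weight_ge0.
(* Every extension of [A] by [elem p r] has order with prime-to-[p] part at most [#|A|], so one
   growth estimate serves all [r]; the value of [d] comes from a crude bound on the number of
   cocycles. *)
have [al [be [C [/andP[al0 al1] be0 C0 grow]]]] := m_k_growth R p_pr G i0 #|A|.
apply: (rpow_decay p_pr (s := (logn p #|A|)%:R) (d := (#|A| * #|A|)%N%:R) al1 C0 (be := be)) => r.
have Lle (c : cocycle A (elem p r)) : exponent_dvd a (ext c) ->
    0 <= L (update G i0 (ext c)) <= C * rpow p (al * ((logn p #|A|)%:R + r%:R) ^+ 2 + be * ((logn p #|A|)%:R + r%:R)).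
  move=> ca; have ua := exp_update _ ca.
  have /andP[-> Lm] := limit_bounds ua (LP _ ua true) => /=.
  have [cp cl] := ext_card_factors c p_pr.
  by apply: le_trans Lm _; have := grow _ cp; rewrite cl natrD.
apply/andP; split.
  by rewrite mulr_ge0 // sumr_ge0 // => c /Lle /andP[].
set M := C * _ in Lle *; have M0 : 0 <= M by rewrite mulr_ge0 // rpow_ge0.
apply: ler_pM => //.
- by rewrite sumr_ge0 // => c /Lle /andP[].
- apply: le_trans (bonf_coef_le R p_pr r).
  rewrite /step_coef ler_piMr //.
    have := coef0 r; rewrite /step_coef pmulr_lge0 // invr_gt0 ltr0n !expn_gt0.
    by rewrite prime_gt0.
  by rewrite invf_le1 ?ler1n ?ltr0n !expn_gt0 prime_gt0.
apply: (@le_trans _ _ (\sum_(c : cocycle A (elem p r)) M)).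
  by rewrite big_mkcond /=; apply: ler_sum => c _; case: ifP => // /Lle/andP[].
rewrite sumr_const -[leLHS]mulr_natl ler_wpM2r // -natrM rpow_nat // ler_nat.
exact: card_cocycle.
Qed.

Lemma sur_weight_cvg (s : seq ('I_k.+1 * nat)) : uniq s -> (forall x, x \in s -> prime x.2) ->
  forall G : groups, (forall i, exponent_dvd a (G i)) ->
    exists l : R, forall b, E b n (sur_weight (sieve s) G) @[n --> \oo] --> l%:E.
Proof.
elim: s => [|[i0 p] s IH] /=.
  by move=> _ _ G Ga; exists (m_k G)%:R => b; exact: moments.
move=> /andP[ps us] s_pr G Ga.
have {}IH : forall G : groups, (forall i, exponent_dvd a (G i)) ->
    exists l : R, forall b, E b n (sur_weight (sieve s) G) @[n --> \oo] --> l%:E.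
  by apply: IH => // x xs; apply: s_pr; rewrite inE xs orbT.
rewrite (_ : sieve ((i0, p) :: s) = fun i => if i == i0 then p :: sieve s i0 else sieve s i).
  apply: sur_weight_cvg_step => //.
  - exact: (s_pr (i0, p) (mem_head _ _)).
  - apply/allP => q /mapP[x]; rewrite mem_filter => /andP[_ xs] ->.
    by apply: s_pr; rewrite inE xs orbT.
  - apply/negP => /mapP[[i q]]; rewrite mem_filter /= => /andP[/eqP-> qs] e.
    by move/negP: ps; rewrite e.
apply/funext => i; rewrite /sieve /= eq_sym.
by case: eqP => [->|].
Qed.

End Limits.

(** * Tightness *)

Section Classes.
Variable a : nat.

Lemma AbClass_repE (c : AbClass a) : sval c = iso_class (AbClass_rep c).
Proof. by rewrite /AbClass_rep; case: cid2. Qed.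

Lemma AbClass_eq (c c' : AbClass a) :
  zmod_iso (AbClass_rep c) (AbClass_rep c') -> c = c'.
Proof.
move=> /iso_classP; rewrite -!AbClass_repE; case: c c' => [c cP] [c' c'P] /= e.
by subst c'; congr exist; exact: Prop_irrelevance.
Qed.

Lemma iso_class_common (G H : finZmodType) (t : table) :
  iso_class G t -> iso_class H t -> zmod_iso G H.
Proof.
move=> [f [f' fK f'K] fD] [g [g' gK g'K] gD].
apply: (@zmod_iso_of _ _ (g' \o f)).
  by move=> x y; apply: (can_inj gK); rewrite /= gD !g'K fD.
by apply: bij_comp; [exists g|exists f'].
Qed.

(** A class is recovered from any table it contains, and a class of order at most [N] contains one
    of finitely many tables; [c0] is a default for tables that belong to no class. *)
Lemma finite_AbClass (N : nat) : finite_set [set c : AbClass a | (#|AbClass_rep c| <= N)%N].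
Proof.
pose T_ (n : 'I_N.+1) : finType := {ffun 'I_n * 'I_n -> 'I_n}.
pose I : finType := {n : 'I_N.+1 & T_ n}.
pose tab (u : I) : table := Table (fun i j => tagged u (i, j)).
have [c0 _] : exists c : AbClass a, True.
  have [|c _] := @AbClass_repP a ('I_1 : finZmodType); last by exists c.
  by apply/exponent_dvdP => x; rewrite [LHS]ord1.
pose psi (u : I) : AbClass a :=
  if pselect (exists c : AbClass a, sval c (tab u)) is left ex then projT1 (cid ex) else c0.
apply: (@sub_finite_set _ _ (psi @` [set: I]%classic)); last by apply: finite_image;
  exact: finite_finset.
move=> c /= cN; pose G := AbClass_rep c.
pose n : 'I_N.+1 := Ordinal (cN : (#|G| < N.+1)%N).
pose op : {ffun 'I_n * 'I_n -> 'I_n} :=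
  [ffun ij => enum_rank (enum_val ij.1 + enum_val ij.2 : G)].
pose u : I := Tagged T_ (op : T_ n).
have ct : sval c (tab u).
  rewrite AbClass_repE; exists (@enum_rank G); first exact: (Bijective enum_rankK enum_valK).
  by move=> x y; rewrite /= ffunE /= !enum_rankK.
exists u => //; rewrite /psi; case: pselect => [ex|]; last by case; exists c.
case: cid => c' /= c't; apply/AbClass_eq/(@iso_class_common _ _ (tab u)).
  by rewrite -AbClass_repE.
by rewrite -AbClass_repE.
Qed.

Lemma finite_AbClass_tuples (k N : nat) : exists A : {fset {ffun 'I_k -> AbClass a}},
  forall h : {ffun 'I_k -> AbClass a}, (forall i, (#|AbClass_rep (h i)| <= N)%N) -> h \in A.
Proof.
have /finite_fsetP[F FE] := finite_AbClass N.
pose T : finType := {ffun 'I_k -> F}.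
pose f (u : T) : {ffun 'I_k -> AbClass a} := [ffun i => val (u i)].
have /finite_fsetP[A AE] : finite_set (f @` [set: T]%classic).
  by apply: finite_image; exact: finite_finset.
exists A => h hN.
have hF i : h i \in F.
  by have : [set` F] (h i) by rewrite -FE; exact: hN.
suff : [set` A] h by [].
rewrite -AE; exists [ffun i => [` hF i]%fset] => //.
by apply/ffunP => i; rewrite !ffunE.
Qed.

End Classes.

Section Tightness.
Variables (R : realType) (k a : nat).
Hypothesis a0 : (0 < a)%N.
Notation J := {ffun 'I_k.+1 -> AbClass a}.
Notation groups := ('I_k.+1 -> finZmodType).
Notation weight := (sur_weight R (a := a) (fun=> [::])).

Lemma exponent_dvd_prod_cyc (G : finZmodType) p :
  exponent_dvd a G -> p \in primes a -> exponent_dvd a (G * cyc p)%type.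
Proof.
move=> /exponent_dvdP aG; rewrite mem_primes => /and3P[p_pr _ /dvdnP[q aE]].
have MnE (u : (G * cyc p)%type) n : u *+ n = (u.1 *+ n, u.2 *+ n).
  elim: n => [|n IH]; first by rewrite !mulr0n.
  by rewrite !mulrS IH.
apply/exponent_dvdP => u; rewrite MnE aG; congr pair.
have zp (z : cyc p) : z *+ p = 0 by have := exponent_mulrn_card z; rewrite card_cyc.
by rewrite aE mulnC mulrnA zp mul0rn.
Qed.

Lemma weight_tail (G : groups) (m : nat) : exists A : {fset J}, forall h, h \notin A ->
  m%:R * weight G h <=
  \sum_(i < k.+1) \sum_(p <- primes a) weight (update G i (G i * cyc p)%type) h.
Proof.
(* [g] bounds all [#Hom(G i, F_p)] at once. Outside [A] some component has more than [g + m]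
   homomorphisms to some [F_p], and the excess over [g] yields the factor [m]. *)
pose g := (\sum_(i < k.+1) \sum_(p <- primes a) #|homs (G i) (cyc p)|)%N.
have [A AP] := finite_AbClass_tuples a k.+1 (a ^ (\sum_(p <- primes a) (g + m)))%N.
exists A => h hA.
have [i big_i] : exists i, (a ^ (\sum_(p <- primes a) (g + m)) < #|AbClass_rep (h i)|)%N.
  apply: contrapT => nex; move/negP: hA; apply; apply: AP => i.
  by rewrite leqNgt; apply/negP => lt; apply: nex; exists i.
set B := AbClass_rep (h i) in big_i.
have aB : forall x : B, x *+ a = 0 by apply/exponent_dvdP; exact: AbClass_rep_exponent.
have [p pa xp] : exists2 p, p \in primes a & (g + m < #|homs B (cyc p)|)%N.
  apply: contrapT => nex; move: big_i; apply/negP; rewrite -leqNgt.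
  apply: leq_trans (card_le_homs a0 aB) _; rewrite leq_pexp2l //.
  rewrite big_seq [leqRHS]big_seq; apply: leq_sum => p pa.
  by rewrite leqNgt; apply/negP => lt; apply: nex; exists p.
have p_pr : prime p by move: pa; rewrite mem_primes => /and3P[].
apply: (@le_trans _ _ (weight (update G i (G i * cyc p)%type) h)); last first.
  rewrite (bigD1 i) //= (bigD1_seq p) ?primes_uniq //= -addrA lerDl addr_ge0 //.
    by rewrite sumr_ge0 // => q _; exact: sur_weight_ge0.
  by rewrite sumr_ge0 // => j _; rewrite sumr_ge0 // => q _; exact: sur_weight_ge0.
have wE (C : finZmodType) : weight (update G i C) h = #|surjs B C|%:R *
    \prod_(j | j != i) (nsurjQ [::] (AbClass_rep (h j)) (G j))%:R.
  rewrite (_ : (fun=> [::]) = fun j => if j == i then [::] else [::]).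
    by rewrite sur_weight_update.
  by apply/funext => j; case: ifP.
rewrite -[G in X in X <= _](update_id G i) !wE mulrA ler_wpM2r //.
  by rewrite prodr_ge0.
rewrite -natrM ler_nat.
have gp : (#|homs (G i) (cyc p)| <= g)%N.
  rewrite /g (bigD1 i) //= (bigD1_seq p) ?primes_uniq //= -addnA; exact: leq_addr.
have := card_surjs_prod_cyc B (G i) p_pr.
move: xp gp; set x := #|homs B _|; set y := #|homs (G i) _|; set s := #|surjs B (G i)|.
set t := #|surjs _ _|; nia.
Qed.

Variable E : nat -> (J -> R) -> \bar R.
Hypothesis Epos : forall n, pos_functional (E n).
Hypothesis moments : forall (G : groups), (forall i, exponent_dvd a (G i)) ->
  E n (weight G) @[n --> \oo] --> (m_k G)%:R%:E.
Variable P : J -> R.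
Hypothesis P_cvg : forall h, E n (fun j => (j == h)%:R) @[n --> \oo] --> (P h)%:E.

Lemma fset_sum_cvg (A : {fset J}) (G : groups) :
  E n (fun j => \sum_(h <- A) weight G h * (j == h)%:R) @[n --> \oo] -->
  (\sum_(h <- A) P h * weight G h)%:E.
Proof.
rewrite -sumEFin (_ : (fun n => _) =
    fun n => (\sum_(h <- A) (weight G h)%:E * E n (fun j => (j == h)%:R))%E).
  apply: cvg_nnesum => h _.
    apply: nearW => n; rewrite mule_ge0 ?lee_fin ?sur_weight_ge0 //.
    exact: pos_functional_ge0.
  by rewrite mulrC EFinM; apply: cvgeZl.
apply/funext => n; rewrite pos_functional_sum // => [|h j]; last first.
  by rewrite mulr_ge0 // sur_weight_ge0.
by apply: eq_bigr => h _; rewrite pos_functionalZ // sur_weight_ge0.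
Qed.

Lemma fset_sumE (A : {fset J}) (G : groups) j :
  \sum_(h <- A) weight G h * (j == h)%:R = if j \in A then weight G j else 0.
Proof.
case: ifP => jA.
  rewrite (bigD1_seq j) //= ?fset_uniq // eqxx mulr1 big1 ?addr0 // => h hj.
  by rewrite eq_sym (negbTE hj) mulr0.
rewrite big_seq big1 // => h hA; case: eqP => [jh|]; last by rewrite mulr0.
by move: jA; rewrite jh hA.
Qed.

(** Positivity bounds every finite partial sum by the moment. Conversely, outside the finite set [A]
    the weight is at most [1 / m] times a quantity whose expectation tends to [K], and [m] is chosen
    so that [K / m <= e]. *)
Lemma esum_moment (G : groups) : (forall i, exponent_dvd a (G i)) ->
  (\esum_(h in [set: J]%classic) (P h * weight G h)%:E = (m_k G)%:R%:E)%E.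
Proof.
move=> Ga; have P0 h : 0 <= P h.
  rewrite -lee_fin; apply: (cvge_to_ge (@P_cvg h)); apply: nearW => n.
  by apply: pos_functional_ge0 => // j; case: (j == h).
have W0 := @sur_weight_ge0 R k a.
apply/eqP; rewrite eq_le; apply/andP; split.
  apply: ge_ereal_sup => _ [A [finA _] <-].
  rewrite fsbig_finite //= sumEFin.
  have lA := @fset_sum_cvg (fset_set A) G.
  apply: (lee_cvg_to lA (moments Ga)); apply: nearW => n.
  apply: pos_functional_le => // j; rewrite fset_sumE.
  by case: ifP => _; rewrite ?W0 ?lexx.
apply/lee_addgt0Pr => e e0.
pose K : R := \sum_(i < k.+1) \sum_(p <- primes a) (m_k (update G i (G i * cyc p)%type))%:R.
have K0 : 0 <= K by rewrite sumr_ge0 // => i _; rewrite sumr_ge0.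
pose m := (Num.truncn (K / e)).+1.
have mK : K <= m%:R * e.
  rewrite -ler_pdivrMr //; apply/ltW/truncnS_gt.
have [A AP] := weight_tail G m.
have tailE : E n (fun j => \sum_(i < k.+1) \sum_(p <- primes a) weight (update G i (G i * cyc p)%type) j)
    @[n --> \oo] --> K%:E.
  rewrite /K -sumEFin (_ : (fun n => _) =
      fun n => (\sum_(i < k.+1) E n (fun j => (\sum_(p <- primes a) weight (update G i (G i * cyc p)%type) j)%R))%E).
    apply: cvg_nnesum => i _.
      by apply: nearW => n; apply: pos_functional_ge0 => // j; rewrite sumr_ge0.
    rewrite -sumEFin big_seq (_ : (fun n => _) =
        fun n => (\sum_(p <- primes a | p \in primes a) E n (weight (update G i (G i * cyc p)%type)))%E).
      apply: cvg_nnesum => p pa; first by apply: nearW => n; apply: pos_functional_ge0.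
      apply: moments => i'; rewrite /update; case: eqP => _ //.
      exact: exponent_dvd_prod_cyc.
    by apply/funext => n; rewrite -big_seq pos_functional_sum.
  by apply/funext => n; rewrite pos_functional_sum // => i j; rewrite sumr_ge0.
have m0 : 0 < m%:R :> R by rewrite ltr0n.
have lim_le : ((m%:R * (m_k G)%:R)%:E <= (m%:R * \sum_(h <- A) P h * weight G h)%:E + K%:E)%E.
  have c1 : (m%:R%:E * E n (weight G))%E @[n --> \oo] --> (m%:R * (m_k G)%:R)%:E.
    by rewrite EFinM; apply: cvgeZl => //; exact: moments.
  have c2 : (m%:R%:E * E n (fun j => (\sum_(h <- A) weight G h * (j == h)%:R)%R) +
      E n (fun j => (\sum_(i < k.+1) \sum_(p <- primes a) weight (update G i (G i * cyc p)%type) j)%R))%E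
      @[n --> \oo] --> ((m%:R * \sum_(h <- A) P h * weight G h)%:E + K%:E)%E.
    by rewrite EFinM; apply: cvgeD => //; apply: cvgeZl => //; exact: fset_sum_cvg.
  apply: (lee_cvg_to c1 c2).
  have s0 j : 0 <= \sum_(i < k.+1) \sum_(p <- primes a) weight (update G i (G i * cyc p)%type) j.
    by rewrite sumr_ge0 // => i _; rewrite sumr_ge0.
  apply: nearW => n; rewrite -!pos_functionalZ //; last by move=> j; rewrite fset_sumE;
    case: ifP.
  rewrite -pos_functionalD //; last by move=> j; rewrite fset_sumE mulr_ge0 //; case: ifP.
  apply: pos_functional_le => // j; rewrite mulr_ge0 //= fset_sumE.
  by case: ifP => [_|/negbT/AP jA]; rewrite ?mulr0 ?add0r // lerDl.
apply: (@le_trans _ _ ((\sum_(h <- A) P h * weight G h)%:E + e%:E)%E).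
  rewrite -EFinD lee_fin; move: lim_le; rewrite -EFinD lee_fin => lim_le.
  by rewrite -(ler_pM2l m0) mulrDr; apply: le_trans lim_le _; rewrite lerD2l.
rewrite leeD2r //; apply: esum_ge; exists [set` A]; first by split.
by rewrite fsbig_finite //= set_fsetK sumEFin.
Qed.

End Tightness.

(** * Random tuples *)

Import mathcomp.classical.classical_sets.
Local Open Scope classical_set_scope.
Local Open Scope ring_scope.
Local Open Scope ereal_scope.

Section RandomClass.
Variables (R : realType) (J : Type) (d : measure_display) (T : measurableType d).
Variables (P : probability T R) (xi : T -> J).
Hypothesis mxi : forall S : set J, measurable (xi @^-1` S).

Definition mean (phi : J -> R) : \bar R := \int[P]_w (phi (xi w))%:E.

Lemma measurable_class (phi : J -> R) : measurable_fun [set: T] ((fun w => (phi (xi w))%:E) : T -> \bar R).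
Proof. by move=> _ Y _; rewrite setTI; exact: (mxi [set j | Y (phi j)%:E]). Qed.

Lemma mean_pos_functional : pos_functional mean.
Proof.
split.
- by move=> phi phi0; apply: integral_ge0 => w _; rewrite lee_fin.
- move=> phi psi phi0 psi0; rewrite /mean; under eq_integral do rewrite EFinD.
  by rewrite ge0_integralD // => [w _||w _|]; rewrite ?lee_fin //; exact: measurable_class.
move=> c phi c0 phi0; rewrite /mean; under eq_integral do rewrite EFinM.
by rewrite ge0_integralZl_EFin // => [w _|]; rewrite ?lee_fin //; exact: measurable_class.
Qed.

Lemma mean_event (S : set J) : mean (fun j => (j \in S)%:R%R) = P (xi @^-1` S).
Proof.
have := integral_indic P measurableT (mxi S); rewrite setIT => <-.
by apply: eq_integral => w _; rewrite indicE.
Qed.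

End RandomClass.

Section Classes.
Variables (k a : nat).
Hypothesis a0 : (0 < a)%N.
Notation J := {ffun 'I_k -> AbClass a}.

(** This replaces a random tuple in a large type by a random variable in the discrete set [J],
    through which both the moments and the events factor. *)
Definition class_of (A : 'I_k -> fgAbGroup) : J :=
  [ffun i => projT1 (cid (tensor_class a0 (@fgab_fin_gen (A i))))].

Lemma class_ofP (A : 'I_k -> fgAbGroup) i :
  zmod_iso (tensor (A i) (Zmod a)) (AbClass_rep (class_of A i)).
Proof. by rewrite ffunE; case: cid. Qed.

Lemma class_of_iso (A B : 'I_k -> fgAbGroup) :
  (forall i, zmod_iso (A i) (B i)) -> class_of A = class_of B.
Proof.
move=> AB; apply/ffunP => i; apply: AbClass_eq.
apply: zmod_iso_trans (class_ofP B i).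
apply: zmod_iso_trans (zmod_iso_sym (class_ofP A i)) _.
exact: zmod_iso_tensor.
Qed.

Lemma measurable_class_of d (T : measurableType d) (X : T -> 'I_k -> fgAbGroup) :
  random_tuple X -> forall S : set J, measurable ((fun w => class_of (X w)) @^-1` S).
Proof.
by move=> mX S; apply: (mX (fun A => S (class_of A))) => A B /class_of_iso ->.
Qed.

Lemma tensor_eventE d (T : measurableType d) (X : T -> 'I_k -> fgAbGroup) (H : 'I_k -> finZmodType) :
  tensor_event a X H = (fun w => class_of (X w)) @^-1`
     [set h : J | forall i, zmod_iso (AbClass_rep (h i)) (H i)].
Proof.
apply/seteqP; split=> w /= XH i.
  exact: zmod_iso_trans (zmod_iso_sym (class_ofP _ i)) (XH i).
exact: zmod_iso_trans (class_ofP _ i) (XH i).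
Qed.

End Classes.

Lemma nSur_finite (a : nat) (B G : finZmodType) : (0 < a)%N ->
  exponent_dvd a B -> exponent_dvd a G -> nSur B G = #|surjs B G|.
Proof.
move=> a0 aB aG; apply: (nSur_eq a0 aG); apply: zmod_iso_sym.
apply: (zmod_iso_of (@tunitD B a)).
have [g gK] := tunit_factor (G := B) (f := id) a0 (elimT (exponent_dvdP _ _) aB) (fun x y => erefl).
exists g => // q; have [x <-] := tunit_surj a0 q; by rewrite gK.
Qed.

Theorem theorem9p1 (R : realType) (k : nat) (hk : (1 <= k)%N)
    (dX dY : nat -> measure_display)
    (OX : forall n, measurableType (dX n)) (OY : forall n, measurableType (dY n))
    (PX : forall n, probability (OX n) R) (PY : forall n, probability (OY n) R)
    (X : forall n, OX n -> 'I_k -> fgAbGroup)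
    (Y : forall n, OY n -> 'I_k -> fgAbGroup)
    (mX : forall n, random_tuple (X n)) (mY : forall n, random_tuple (Y n))
    (a : nat) (ha : (0 < a)%N)
    (momX : forall G : 'I_k -> finZmodType, (forall i, exponent_dvd a (G i)) ->
      'E_(PX n)[fun w => (\prod_(i < k) (nSur (X n w i) (G i))%:R)%R]
        @[n --> \oo] --> ((m_k G)%:R%:E : \bar R))
    (momY : forall G : 'I_k -> finZmodType, (forall i, exponent_dvd a (G i)) ->
      'E_(PY n)[fun w => (\prod_(i < k) (nSur (Y n w i) (G i))%:R)%R]
        @[n --> \oo] --> ((m_k G)%:R%:E : \bar R)) :
  (forall H : 'I_k -> finZmodType, (forall i, exponent_dvd a (H i)) ->
     cvg (PX n (tensor_event a (X n) H) @[n --> \oo])) /\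
  (forall G : 'I_k -> finZmodType, (forall i, exponent_dvd a (G i)) ->
     \esum_(h in [set: {ffun 'I_k -> AbClass a}])
       (lim (PX n (tensor_event a (X n) (fun i => AbClass_rep (h i))) @[n --> \oo])
        * (\prod_(i < k) (nSur (AbClass_rep (h i)) (G i))%:R)%R%:E)
     = (m_k G)%:R%:E) /\
  (forall H : 'I_k -> finZmodType, (forall i, exponent_dvd a (H i)) ->
     cvg (PY n (tensor_event a (Y n) H) @[n --> \oo]) /\
     lim (PX n (tensor_event a (X n) H) @[n --> \oo]) =
     lim (PY n (tensor_event a (Y n) H) @[n --> \oo])).
Proof.
case: k hk X Y mX mY momX momY => // k _ X Y mX mY momX momY.
pose xiX n w := class_of ha (X n w); pose xiY n w := class_of ha (Y n w).
pose E (b : bool) n := if b then mean (PX n) (xiX n) else mean (PY n) (xiY n).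
have mxX n := measurable_class_of ha (mX n).
have mxY n := measurable_class_of ha (mY n).
have Epos b n : pos_functional (E b n) by case: b; exact: mean_pos_functional.
have weightE (A : 'I_k.+1 -> fgAbGroup) (G : 'I_k.+1 -> finZmodType) :
    (forall i, exponent_dvd a (G i)) ->
    (\prod_(i < k.+1) (nSur (A i) (G i))%:R)%R = sur_weight R (fun=> [::]) G (class_of ha A).
  by move=> Ga; apply: eq_bigr => i _; rewrite (nSur_eq ha (Ga i) (class_ofP ha A i)).
have moments b (G : 'I_k.+1 -> finZmodType) : (forall i, exponent_dvd a (G i)) ->
    E b n (sur_weight R (fun=> [::]) G) @[n --> \oo] --> ((m_k G)%:R%:E : \bar R).
  move=> Ga; case: b => /=.
    apply: cvg_trans (momX G Ga); apply: near_eq_cvg; apply: nearW => n.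
    by rewrite unlock; apply: eq_integral => w _; rewrite weightE.
  apply: cvg_trans (momY G Ga); apply: near_eq_cvg; apply: nearW => n.
  by rewrite unlock; apply: eq_integral => w _; rewrite weightE.
pose s := [seq (i, p) | i <- enum 'I_k.+1, p <- primes a].
have s_uniq : uniq s.
  by apply: allpairs_uniq; rewrite ?enum_uniq ?primes_uniq // => -[i p] [j q].
have s_prime x : x \in s -> prime x.2.
  by move=> /allpairsP[[i p] /= [_ + ->]]; rewrite mem_primes => /and3P[].
have sieveP i : all prime (sieve s i) /\ {subset primes a <= sieve s i}.
  split=> [|p pa].
    by apply/allP => q /mapP[x]; rewrite mem_filter => /andP[_ xs ->]; exact: s_prime.
  apply/mapP; exists (i, p) => //; rewrite mem_filter /= eqxx /=.
  by apply/allpairsP; exists (i, p); rewrite mem_enum.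
pose ev (H : 'I_k.+1 -> finZmodType) : set {ffun 'I_k.+1 -> AbClass a} :=
  [set h | forall i, zmod_iso (AbClass_rep (h i)) (H i)].
have event_cvg (H : 'I_k.+1 -> finZmodType) : (forall i, exponent_dvd a (H i)) ->
    exists l : R, forall b, E b n (fun h => (h \in ev H)%:R%R) @[n --> \oo] --> l%:E.
  move=> Ha; have [l lE] := sur_weight_cvg Epos moments s_uniq s_prime Ha.
  (* After the full sieve the weight is the indicator of the event times [c], the product of the
     numbers of automorphisms of the [H i]. *)
  pose c : R := (\prod_i #|surjs (H i) (H i)|%:R)%R.
  have c0 : (0 < c)%R by apply: prodr_gt0 => i _; rewrite ltr0n card_surjs_self_gt0.
  exists (c^-1 * l)%R => b.
  rewrite (_ : (fun n => _) = fun n => (c^-1)%:E * E b n (sur_weight R (sieve s) H)).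
    by rewrite EFinM; apply: cvgeZl.
  apply/funext => n; rewrite -pos_functionalZ ?invr_ge0 ?ltW //; last first.
    by move=> h; exact: sur_weight_ge0.
  congr (E b n _); apply/funext => h; rewrite /sur_weight.
  rewrite (eq_bigr (fun i => (`[< zmod_iso (AbClass_rep (h i)) (H i) >]%:R *
    #|surjs (H i) (H i)|%:R)%R)); last first.
    move=> i _; have [s_pr s_a] := sieveP i.
    by rewrite (nsurjQ_full _ ha (AbClass_rep_exponent _) s_pr s_a) natrM.
  rewrite big_split /= -/c mulrCA mulVf ?mulr1 ?gt_eqF //.
  have [hH|hH] := boolP (h \in ev H).
    rewrite big1 // => i _; have /(_ i) {}hH := set_mem hH.
    by rewrite asboolT.
  have [i ni] : exists i, ~ zmod_iso (AbClass_rep (h i)) (H i).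
    apply: contrapT => nex; move/negP: hH; apply; apply: mem_set => i.
    by apply: contrapT => ni; apply: nex; exists i.
  by rewrite (bigD1 i) //= asboolF // mul0r.
have PXE H n : PX n (tensor_event a (X n) H) = E true n (fun h => (h \in ev H)%:R%R).
  by rewrite (tensor_eventE ha) -mean_event.
have PYE H n : PY n (tensor_event a (Y n) H) = E false n (fun h => (h \in ev H)%:R%R).
  by rewrite (tensor_eventE ha) -mean_event.
have cvgX (H : 'I_k.+1 -> finZmodType) l : (forall b, E b n (fun h => (h \in ev H)%:R%R) @[n --> \oo] --> l%:E) ->
    PX n (tensor_event a (X n) H) @[n --> \oo] --> l%:E.
  by move=> lE; under eq_fun do rewrite PXE; exact: lE.
have cvgY (H : 'I_k.+1 -> finZmodType) l : (forall b, E b n (fun h => (h \in ev H)%:R%R) @[n --> \oo] --> l%:E) ->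
    PY n (tensor_event a (Y n) H) @[n --> \oo] --> l%:E.
  by move=> lE; under eq_fun do rewrite PYE; exact: lE.
split; last split.
- by move=> H /event_cvg[l /cvgX lX]; apply/cvg_ex; exists l%:E.
- move=> G Ga.
  have ex (h : {ffun 'I_k.+1 -> AbClass a}) : exists l : R, forall b,
      E b n (fun j => (j \in ev (fun i => AbClass_rep (h i)))%:R%R) @[n --> \oo] --> l%:E.
    by apply: event_cvg => i; exact: AbClass_rep_exponent.
  have [p pE] := choice ex.
  (* For chosen representatives the event is a single point of [J], so the limits at points required
     by [esum_moment] are limits of probabilities. *)
  have evE (h j : {ffun 'I_k.+1 -> AbClass a}) : (j \in ev (fun i => AbClass_rep (h i))) = (j == h).
    apply/idP/eqP => [|->]; last by apply: mem_set => i; exact: zmod_iso_refl.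
    by move=> /set_mem jh; apply/ffunP => i; exact: AbClass_eq (jh i).
  rewrite -(esum_moment ha (Epos true) (moments true) (P := p) _ Ga).
    apply: eq_esum => h _; rewrite (cvg_lim _ (cvgX _ _ (pE h))) // EFinM; congr (_ * _%:E).
    by apply: eq_bigr => i _; rewrite (nSur_finite ha _ (Ga i)) // AbClass_rep_exponent.
  move=> h; have := pE h true; apply: cvg_trans; apply: near_eq_cvg; apply: nearW => n.
  by congr (E true n _); apply/funext => j; rewrite evE.
move=> H /event_cvg[l lE]; split; first by apply/cvg_ex; exists l%:E; exact: cvgY.
by rewrite (cvg_lim _ (cvgX _ _ lE)) // (cvg_lim _ (cvgY _ _ lE)).
Qed.
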